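(* Let $X$ be a measurable space and let $\mathcal P(X)$ be the set of probability measures on $X$. The space $(\mathcal P(X)\times\mathcal P(X),\operatorname{FR}^2)$, where $\operatorname{FR}$ is the Fisher--Rao distance, satisfies condition (NNCC-conv) and is thus an NNCC space.
   Context: The Hellinger distance is given by $\mathcal H^2(\mu,\nu)=\int_X\Big(\sqrt{\frac{d\mu}{d\lambda}}-\sqrt{\frac{d\nu}{d\lambda}}\Big)^2d\lambda$, where $\lambda$ is any measure dominating both $\mu$ and $\nu$. The Fisher--Rao distance is $\operatorname{FR}(\mu,\nu)=\arccos\big(1-\frac12\mathcal H^2(\mu,\nu)\big)$, i.e. the intrinsic (great-circle) distance between $\sqrt{d\mu/d\lambda}$ and $\sqrt{d\nu/d\lambda}$ on the unit sphere of $L^2(\lambda)$. Condition (NNCC-conv) for a finite cost $c\colon A\times B\to\mathbb R$: for any $x_0,x_1\in A$ and $\bar y\in B$ there exists a path $\mathrm x\colon[0,1]\to A$ (an arbitrary function) with $\mathrm x(0)=x_0$, $\mathrm x(1)=x_1$ such that for every $y\in B$ the function $s\mapsto c(\mathrm x(s),\bar y)-c(\mathrm x(s),y)$ is convex on $[0,1]$. $(A\times B,c)$ is an NNCC space if for any $x_0,x_1\in A$, $\bar y\in B$ there is a path $\mathrm x\colon[0,1]\to A$ with $\mathrm x(0)=x_0$, $\mathrm x(1)=x_1$ such that for all $s\in(0,1)$ and $y\in B$, $c(\mathrm x(s),\bar y)-c(\mathrm x(s),y)\le(1-s)[c(x_0,\bar y)-c(x_0,y)]+s[c(x_1,\bar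 y)-c(x_1,y)]$. *)

(* Defs.v *)
From HB Require Import structures.
From mathcomp Require Import all_boot all_order all_algebra.
From mathcomp Require Import all_classical all_reals all_analysis.
From mathcomp Require Import measurable_realfun.
Import Order.TTheory GRing.Theory Num.Theory.
Import numFieldNormedType.Exports.
Set Implicit Arguments.
Unset Strict Implicit.
Unset Printing Implicit Defensive.

Local Open Scope classical_set_scope.
Local Open Scope ring_scope.
Local Open Scope charge_scope.

(* A path [0,1] -> A is given by a function on the whole of R whose values
   outside [0,1] are irrelevant. *)
Definition NNCC_conv (R : realType) (A B : Type) (c : A -> B -> R) : Prop :=
  forall (x0 x1 : A) (ybar : B), exists x : R -> A,
    [/\ x 0 = x0, x 1 = x1 &
        forall y : B,
          convex_function (`[0, 1]%classic : set R^o)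
            (fun s : R => c (x s) ybar - c (x s) y)].

Definition NNCC_space (R : realType) (A B : Type) (c : A -> B -> R) : Prop :=
  forall (x0 x1 : A) (ybar : B), exists x : R -> A,
    [/\ x 0 = x0, x 1 = x1 &
        forall (s : R) (y : B), 0 < s < 1 ->
          c (x s) ybar - c (x s) y <=
            (1 - s) * (c x0 ybar - c x0 y) + s * (c x1 ybar - c x1 y)].

Definition sum_measure d (T : measurableType d) (R : realType)
    (mu nu : {finite_measure set T -> \bar R}) : set T -> \bar R :=
  measure_add mu nu.

HB.instance Definition _ d (T : measurableType d) (R : realType)
    (mu nu : {finite_measure set T -> \bar R}) :=
  Measure.on (sum_measure mu nu).

Lemma sum_measure_fin d (T : measurableType d) (R : realType)
    (mu nu : {finite_measure set T -> \bar R}) :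
  fin_num_fun (sum_measure mu nu).
Proof.
by move=> A mA; rewrite /sum_measure measure_addE fin_numD !fin_num_measure.
Qed.

HB.instance Definition _ d (T : measurableType d) (R : realType)
    (mu nu : {finite_measure set T -> \bar R}) :=
  Measure_isFinite.Build _ T R (sum_measure mu nu) (sum_measure_fin mu nu).

Definition hellinger2_wrt d (T : measurableType d) (R : realType)
    (la : {sigma_finite_measure set T -> \bar R})
    (mu nu : {finite_measure set T -> \bar R}) : R :=
  \int[la]_x
    (Num.sqrt (fine (('d (charge_of_finite_measure mu) '/d la) x)) -
     Num.sqrt (fine (('d (charge_of_finite_measure nu) '/d la) x))) ^+ 2.

(* The dominating measure is taken to be mu + nu; by [hellinger2_wrtE] below,
   any other sigma-finite dominating measure gives the same value. *)
Definition hellinger2 d (T : measurableType d) (R : realType)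
    (mu nu : {finite_measure set T -> \bar R}) : R :=
  hellinger2_wrt (sum_measure mu nu) mu nu.

Definition FR d (T : measurableType d) (R : realType)
    (mu nu : probability T R) : R :=
  acos (1 - 2^-1 * hellinger2 mu nu).

Definition FR2 d (T : measurableType d) (R : realType)
    (mu nu : probability T R) : R :=
  FR mu nu ^+ 2.

Lemma hellinger2_wrtE d (T : measurableType d) (R : realType)
    (la : {sigma_finite_measure set T -> \bar R})
    (mu nu : {finite_measure set T -> \bar R}) :
  mu `<< la -> nu `<< la -> hellinger2_wrt la mu nu = hellinger2 mu nu.
Proof.
move=> mula nula; rewrite /hellinger2.
set rho : {finite_measure set T -> \bar R} := sum_measure mu nu.
have rhoE A : rho A = (mu A + nu A)%E by exact: measure_addE.
have murho : mu `<< rho.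
  apply/null_content_dominatesP => A mA rA0; apply/eqP.
  move/eqP: (etrans (esym (rhoE A)) rA0).
  by rewrite padde_eq0 ?measure_ge0// => /andP[].
have nurho : nu `<< rho.
  apply/null_content_dominatesP => A mA rA0; apply/eqP.
  move/eqP: (etrans (esym (rhoE A)) rA0).
  by rewrite padde_eq0 ?measure_ge0// => /andP[].
have rhola : rho `<< la.
  apply/null_content_dominatesP => A mA lA0; apply: (etrans (rhoE A)).
  have /null_content_dominatesP mu0 := mula.
  have /null_content_dominatesP nu0 := nula.
  by rewrite mu0// nu0// adde0.
pose w := Radon_Nikodym_SigmaFinite.f rho la.
have mw : measurable_fun setT w.
  exact: measurable_int (Radon_Nikodym_SigmaFinite.f_integrable rhola).
have chain (m : {finite_measure set T -> \bar R}) : m `<< rho ->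
    ae_eq la setT ('d (charge_of_finite_measure m) '/d la)
      ('d (charge_of_finite_measure m) '/d rho \* w)%E.
  move=> mrho.
  apply: (ae_eq_trans (Radon_Nikodym_chain_rule
    (nu := charge_of_finite_measure m) mrho rhola)).
  apply: ae_eqe_mul2l; apply: ae_eq_sym.
  exact: ae_eq_Radon_Nikodym_SigmaFinite.
have mD (m : {finite_measure set T -> \bar R})
    (k : {sigma_finite_measure set T -> \bar R}) : m `<< k ->
    measurable_fun setT (fun x =>
      Num.sqrt (fine (('d (charge_of_finite_measure m) '/d k) x))).
  move=> mk; apply: measurableT_comp; first 
    by apply: continuous_measurable_fun; exact: sqrt_continuous.
  apply: measurableT_comp; first exact: fine_measurable.
  exact: measurable_int
    (Radon_Nikodym_integrable (nu := charge_of_finite_measure m) mk).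
rewrite /hellinger2_wrt /Rintegral; congr fine.
have mh : measurable_fun setT (fun x => ((Num.sqrt
      (fine (('d (charge_of_finite_measure mu) '/d rho) x)) -
    Num.sqrt
      (fine (('d (charge_of_finite_measure nu) '/d rho) x))) ^+ 2)%:E).
  apply/measurable_EFinP; apply: measurable_funX.
  by apply: measurable_funB; exact: mD.
rewrite -(Radon_Nikodym_SigmaFinite.change_of_variables rhola)//; last first.
  by move=> x; rewrite lee_fin sqr_ge0.
apply: ae_eq_integral => //.
- apply/measurable_EFinP; apply: measurable_funX.
  by apply: measurable_funB; exact: mD.
- exact: emeasurable_funM.
- apply: filterS2 (chain _ murho) (chain _ nurho) => x /(_ I) -> /(_ I) -> _.
  have wx := Radon_Nikodym_SigmaFinite.f_fin_num rhola x.
  have w0 := Radon_Nikodym_SigmaFinite.f_ge0 rhola x.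
  rewrite /= -/w in wx w0 *.
  rewrite !fineM ?Radon_Nikodym_fin_num//.
  have fw0 : 0 <= fine (w x) by exact: fine_ge0.
  rewrite ![_ * fine (w x)]mulrC !sqrtrM// -mulrBr exprMn sqr_sqrtr//.
  by rewrite EFinM fineK// muleC.
Qed.

(* Main.v *)
Require Import Defs.
From HB Require Import structures.
From mathcomp Require Import all_boot all_order all_algebra.
From mathcomp Require Import all_classical all_reals all_analysis.
From mathcomp Require Import measurable_realfun.
From mathcomp Require Import ring lra.
Import Order.TTheory GRing.Theory Num.Theory.
Import numFieldNormedType.Exports.
Set Implicit Arguments.
Unset Strict Implicit.
Unset Printing Implicit Defensive.
Local Open Scope classical_set_scope.
Local Open Scope ring_scope.
Local Open Scope charge_scope.

(** Fix a measure dominating the measures at hand and represent a probability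
    measure by the square root of its density. This is a nonnegative unit
    vector of L2, and the Fisher-Rao distance of two measures is the angle of
    their vectors. The theorem is therefore a statement on the nonnegative part
    of the unit sphere of a Hilbert space, with cost the squared angle.

    Let [g], [f0], [f1] be the unit vectors of [ybar], [x0], [x1], and let [v0],
    [v1] be the logarithms of [f0], [f1] at [g]: the tangent vectors orthogonal
    to [g] whose exponentials are [f0] and [f1]. The path is the exponential
    at [g] of the segment v(s) = (1 - s) v0 + s v1 (a c-segment in the language
    of optimal transport). The squared angle from its point to [g] is |v(s)|^2,
    so two things are needed: the path consists of nonnegative functions, so
    that their squares are again densities ([csegment_ge0]), and
    |v(s)|^2 - angle(exp v(s), h)^2 is a convex function of s for every
    nonnegative h in the unit ball, the angle being the arc cosine of the inner
    product ([csegment_convex]).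

    Nonnegativity. With r = |v(s)|, the function exp v(s) has nonnegative
    coefficients on [f0] and [f1], and its coefficient on [g] is nonnegative
    because t |-> 1 - t cot t is nondecreasing and convex on ]0, pi/2] and r is
    at most the average of the two angles ([onemcot_tangent]).

    Convexity. Only inner products matter, so the vectors may be taken in a
    four-dimensional space, and the segment on the line of vectors a e1 + s e2
    with e1, e2 orthonormal and orthogonal to [g] ([gram_line_convex]). The
    second derivative of s^2 - angle^2 is a quadratic form in the direction of
    the line; this is the cross-curvature of the sphere. Its nonnegativity
    ([cross_curvature_form]) reduces, in the worst position of h, to the
    assertion that G(t) = t^2 / (1 - t cot t) lies below its tangent at r
    ([sqr_onemcot_tangent]). The function G is concave because it solves the
    Riccati equation t G' = 3 G - G^2 - t^2 and satisfies 1 <= G <= 3 - t^2 / 6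
    ([sqr_onemcot2_le0]).

    The formulas are singular where the line passes through the origin or
    the path meets h. Lines through the origin give great circles and are
    treated apart; the other singularity disappears when h is shrunk by a
    factor e < 1, and the inequality between values passes to the limit.

    The path has to be chosen before the fourth measure y, which need not have
    a density with respect to x0 + x1 + ybar. Only its absolutely continuous
    part contributes to the angles with the path, and it is represented by a
    vector h of norm at most 1 ([FR2_inner_root_density]); this is why the
    spherical lemmas allow such h. *)

(** * Derivatives and convexity *)

Section calculus.
Context {R : realType}.
Implicit Types (f g df dg : R -> R) (a b x y t : R).

Lemma is_derive_add f g x u v : is_derive x 1 f u -> is_derive x 1 g v ->
  is_derive x 1 (fun t => f t + g t) (u + v).
Proof. by move=> ? ?; exact: is_deriveD. Qed.

Lemma is_derive_sub f g x u v : is_derive x 1 f u -> is_derive x 1 g v ->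
  is_derive x 1 (fun t => f t - g t) (u - v).
Proof. by move=> ? ?; exact: is_deriveB. Qed.

Lemma is_derive_mul f g x u v : is_derive x 1 f u -> is_derive x 1 g v ->
  is_derive x 1 (fun t => f t * g t) (f x * v + g x * u).
Proof. by move=> ? ?; exact: is_deriveM. Qed.

Lemma is_derive_exp f n x u : is_derive x 1 f u ->
  is_derive x 1 (fun t => f t ^+ n) (n%:R * f x ^+ n.-1 * u).
Proof.
move=> df; rewrite (_ : (fun t => f t ^+ n) = f ^+ n); first exact: is_deriveX.
by apply/funext => t; rewrite exprfctE.
Qed.

Lemma is_derive_div f g x u v : g x != 0 ->
  is_derive x 1 f u -> is_derive x 1 g v ->
  is_derive x 1 (fun t => f t / g t) ((u * g x - f x * v) / g x ^+ 2).
Proof.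
move=> gx0 df dg.
have dV : is_derive x 1 (fun t => (g t)^-1) (- (g x) ^- 2 *: v).
  exact: is_deriveV.
apply: is_derive_eq (is_derive_mul df dV) _.
by rewrite /GRing.scale/=; field.
Qed.

Lemma is_derive_chain f g x u v : is_derive x 1 f u -> is_derive (f x) 1 g v ->
  is_derive x 1 (fun t => g (f t)) (v * u).
Proof. by move=> df dg; exact: is_derive1_comp dg df. Qed.

Lemma is_derive_const (c : R) x : is_derive x 1 (fun=> c) 0.
Proof. exact: is_derive_cst. Qed.

Lemma is_derive_var x : is_derive x 1 (fun t : R => t) 1.
Proof. exact: is_derive_id. Qed.

Lemma is_derive_continuous f x u : is_derive x 1 f u -> {for x, continuous f}.
Proof. by case=> /derivable1_diffP/differentiable_continuous. Qed.

Lemma derive_ge0_le f df a b : a <= b ->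
  (forall x, a <= x <= b -> is_derive x 1 f (df x)) ->
  (forall x, a <= x <= b -> 0 <= df x) -> f a <= f b.
Proof.
move=> ab fdf df0.
have [c cab E] : exists2 c, c \in `[a, b] & f b - f a = df c * (b - a).
  apply: MVT_segment => // [x xab|].
    by apply: fdf; rewrite !ltW ?(itvP xab).
  apply: continuous_in_subspaceT => x; rewrite inE/= in_itv/= => xab.
  exact: is_derive_continuous (fdf _ xab).
by rewrite -subr_ge0 E mulr_ge0 ?subr_ge0// df0// -in_itv.
Qed.

Lemma derive_ge0_ge0 f df t : 0 <= t -> 0 <= f 0 ->
  (forall x, 0 <= x <= t -> is_derive x 1 f (df x)) ->
  (forall x, 0 <= x <= t -> 0 <= df x) -> 0 <= f t.
Proof.
by move=> t0 f0 fdf df0; rewrite (le_trans f0)// (derive_ge0_le t0 fdf).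
Qed.

Lemma conv_itv a b x y t : a <= x <= b -> a <= y <= b -> 0 <= t <= 1 ->
  a <= (1 - t) * x + t * y <= b.
Proof.
move=> /andP[ax xb] /andP[ay yb] /andP[t0 t1].
have : 0 <= (1 - t) * (x - a) by rewrite mulr_ge0 ?subr_ge0.
have : 0 <= t * (y - a) by rewrite mulr_ge0 ?subr_ge0.
have : 0 <= (1 - t) * (b - x) by rewrite mulr_ge0 ?subr_ge0.
have : 0 <= t * (b - y) by rewrite mulr_ge0 ?subr_ge0.
by move=> *; apply/andP; split; lra.
Qed.

Lemma convex_tangent f df ddf a b x y :
  (forall z, a <= z <= b -> is_derive z 1 f (df z)) ->
  (forall z, a <= z <= b -> is_derive z 1 df (ddf z)) ->
  (forall z, a <= z <= b -> 0 <= ddf z) ->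
  a <= x <= b -> a <= y <= b -> f x + df x * (y - x) <= f y.
Proof.
move=> fdf dfddf ddf0 /andP[ax xb] /andP[ay yb].
have ndf u v : a <= u -> u <= v -> v <= b -> df u <= df v.
  move=> au uv vb; apply: (derive_ge0_le uv) => z /andP[uz zv].
    by apply: dfddf; rewrite (le_trans au)// (le_trans zv).
  by apply: ddf0; rewrite (le_trans au)// (le_trans zv).
pose h z := f z - df x * z.
have dh z : a <= z <= b -> is_derive z 1 h (df z - df x).
  move=> /fdf dfz; have := is_derive_sub dfz
    (is_derive_mul (is_derive_const (df x) z) (is_derive_var z)).
  by rewrite mulr1 mulr0 addr0.
suff : h x <= h y by rewrite /h; lra.
have [xy|/ltW yx] := leP x y.
  apply: (derive_ge0_le xy) => z /andP[xz zy].
    by apply: dh; rewrite (le_trans ax)// (le_trans zy).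
  by rewrite subr_ge0 ndf// (le_trans zy).
rewrite -lerN2.
apply: (@derive_ge0_le (fun z => - h z) (fun z => df x - df z) _ _ yx)
  => z /andP[yz zx].
  rewrite -opprB; apply: is_deriveN.
  by apply: dh; rewrite (le_trans ay)// (le_trans zx).
by rewrite subr_ge0 ndf// (le_trans ay).
Qed.

End calculus.

(** The derivatives found by instance resolution contain scaling
    operations, which the ring tactics do not normalize; those of the rules
    above do not. *)
Ltac derive :=
  repeat first
  [ exact: is_derive_const | exact: is_derive_var
  | exact: is_derive_sin | exact: is_derive_cos
  | simple notypeclasses refine (is_derive_sub _ _)
  | simple notypeclasses refine (is_derive_add _ _)
  | simple notypeclasses refine (is_derive_div _ _ _)
  | simple notypeclasses refine (is_derive_mul _ _)
  | simple notypeclasses refine (is_derive_exp _ _) ].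

Ltac derive_eq :=
  simple notypeclasses refine (is_derive_eq _ _); [shelve|derive|rewrite /=].

(** * Trigonometric inequalities *)

Section trigo_inequalities.
Context {R : realType}.
Implicit Types t r : R.

Lemma le_mulcos_sin t : 0 <= t <= pi / 2 -> t * cos t <= sin t.
Proof.
move=> /andP[t0 tpi]; rewrite -subr_ge0.
apply: (@derive_ge0_ge0 _ (fun z => sin z - z * cos z)
  (fun z => z * sin z)) => //.
- by rewrite sin0; lra.
- by move=> z _; derive_eq; ring.
- move=> z /andP[z0 zt]; have pi0 := @pi_ge0 R.
  by rewrite mulr_ge0// sin_ge0_pi// z0/=; lra.
Qed.

(** The bound t^2 / (1 - t cot t) <= 3 - t^2 / 6 without denominators. The
    expansion of the left-hand side at 0 is 3 - t^2 / 5, so there is room. *)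
Lemma le_mulcos_sin_rational t : 0 <= t <= pi / 2 ->
  (18 - t ^+ 2) * (t * cos t) <= (18 - 7 * t ^+ 2) * sin t.
Proof.
move=> /andP[t0 tpi]; rewrite -subr_ge0.
pose E z : R := (4 - z ^+ 2) * sin z - 4 * z * cos z.
have E0 z : 0 <= z <= t -> 0 <= E z.
  move=> /andP[z0 zt].
  apply: (@derive_ge0_ge0 _ E (fun z => z * (2 * sin z - z * cos z))) => //.
  - by rewrite /E sin0; lra.
  - by move=> x _; rewrite /E; derive_eq; ring.
  - move=> x /andP[x0 xz]; rewrite mulr_ge0//.
    have := @le_mulcos_sin x; have pi0 := @pi_ge0 R.
    have : 0 <= sin x by rewrite sin_ge0_pi// x0/=; lra.
    by rewrite x0/=; lra.
apply: (@derive_ge0_ge0 _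
  (fun z => (18 - 7 * z ^+ 2) * sin z - (18 - z ^+ 2) * (z * cos z))
  (fun z => z * E z)) => //.
- by rewrite sin0; lra.
- by move=> z _; rewrite /E; derive_eq; ring.
- by move=> z /andP[z0 zt]; rewrite mulr_ge0// E0// z0.
Qed.

(** The bound 1 - t cot t <= t^2 without denominators. *)
Lemma le_sin_mulcos_sqr t : 0 <= t <= pi / 2 ->
  sin t <= t * cos t + t ^+ 2 * sin t.
Proof.
move=> /andP[t0 tpi]; rewrite -subr_ge0.
apply: (@derive_ge0_ge0 _ (fun z => z * cos z + z ^+ 2 * sin z - sin z)
   (fun z => z * sin z + z ^+ 2 * cos z)) => //.
- by rewrite sin0; lra.
- by move=> z _; derive_eq; ring.
- move=> z /andP[z0 zt]; have pi0 := @pi_ge0 R.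
  rewrite addr_ge0// mulr_ge0 ?exprn_ge0//.
    by rewrite sin_ge0_pi// z0/=; lra.
  by apply: cos_ge0_pihalf; lra.
Qed.

Lemma le_sin_sqr t : 0 <= t <= pi / 2 ->
  2 * sin t ^+ 2 <= t ^+ 2 + t * sin t * cos t.
Proof.
move=> /andP[t0 tpi]; rewrite -subr_ge0.
pose E z : R := 2 * z - 3 * (sin z * cos z) + z * (cos z ^+ 2 - sin z ^+ 2).
have E0 z : 0 <= z <= t -> 0 <= E z.
  move=> /andP[z0 zt].
  apply: (@derive_ge0_ge0 _ E (fun z => 4 * sin z * (sin z - z * cos z))) => //.
  - by rewrite /E sin0; lra.
  - move=> x _; rewrite /E; derive_eq.
    by have := cos2Dsin2 x; rewrite /=; nra.
  - move=> x /andP[x0 xz]; have pi0 := @pi_ge0 R.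
    have sx : 0 <= sin x by rewrite sin_ge0_pi// x0/=; lra.
    rewrite mulr_ge0//; first by rewrite mulr_ge0.
    by rewrite subr_ge0 le_mulcos_sin// x0/=; lra.
apply: (@derive_ge0_ge0 _
  (fun z => z ^+ 2 + z * sin z * cos z - 2 * sin z ^+ 2) E) => //.
- by rewrite sin0; lra.
- by move=> z _; rewrite /E; derive_eq; ring.
Qed.

End trigo_inequalities.

(** * The functions 1 - t cot t and t^2 / (1 - t cot t) *)

Section cotangent.
Context {R : realType}.
Implicit Types t r z : R.

Definition onemcot t : R := 1 - t * cos t / sin t.

Definition onemcot1 t : R := (t - sin t * cos t) / sin t ^+ 2.

Lemma sin_gt0_pihalf_le t : 0 < t <= pi / 2 -> 0 < sin t.
Proof.
move=> /andP[t0 tpi]; have pi0 := @pi_gt0 R.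
by apply: sin_gt0_pi; rewrite t0/=; lra.
Qed.

Lemma pihalf_sqr_lt t : 0 < t <= pi / 2 -> t ^+ 2 < 4.
Proof.
have := @pihalf_02 R; rewrite -/(pi / 2) => /andP[_ pi2] /andP[t0 tpi].
have : t < 2 by lra.
by nra.
Qed.

Lemma onemcot_ge_rational t : 0 < t <= pi / 2 ->
  6 * t ^+ 2 <= (18 - t ^+ 2) * onemcot t.
Proof.
move=> tI; have s0 := sin_gt0_pihalf_le tI; have t4 := pihalf_sqr_lt tI.
have [t0 tpi] := andP tI.
have := @le_mulcos_sin_rational R t; rewrite (ltW t0) tpi => /(_ isT) H.
rewrite -(ler_pM2r s0) /onemcot.
suff -> : (18 - t ^+ 2) * (1 - t * cos t / sin t) * sin t =
  (18 - t ^+ 2) * sin t - (18 - t ^+ 2) * (t * cos t) by lra.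
by field; rewrite gt_eqF.
Qed.

Lemma onemcot_gt0 t : 0 < t <= pi / 2 -> 0 < onemcot t.
Proof.
move=> tI; have := onemcot_ge_rational tI; have t4 := pihalf_sqr_lt tI.
have t2 : 0 < t ^+ 2 by rewrite exprn_gt0//; case/andP: tI.
by nra.
Qed.

Lemma onemcot_le_sqr t : 0 < t <= pi / 2 -> onemcot t <= t ^+ 2.
Proof.
move=> tI; have s0 := sin_gt0_pihalf_le tI; have [t0 tpi] := andP tI.
have := @le_sin_mulcos_sqr R t; rewrite (ltW t0) tpi => /(_ isT) H.
rewrite -(ler_pM2r s0) /onemcot.
suff -> : (1 - t * cos t / sin t) * sin t = sin t - t * cos t by lra.
by field; rewrite gt_eqF.
Qed.

(** This turns t / sin t into a polynomial in t and [onemcot t], so that the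
    derivatives below become Riccati equations. *)
Lemma sqr_div_sin t : sin t != 0 ->
  (t / sin t) ^+ 2 = t ^+ 2 + (1 - onemcot t) ^+ 2.
Proof.
move=> s0; have := cos2Dsin2 t => cs.
rewrite /onemcot subKr !expr_div_n exprMn -[t ^+ 2 in LHS]mulr1.
rewrite -[X in _ * X / _]cs.
by field.
Qed.

Lemma sin_le_id t : 0 <= t -> sin t <= t.
Proof.
move=> t0; rewrite -subr_ge0.
apply: (@derive_ge0_ge0 _ (fun z => z - sin z) (fun z => 1 - cos z)) => //.
by rewrite sin0 subrr.
Qed.

Lemma is_derive_onemcot t : sin t != 0 ->
  is_derive t 1 onemcot (onemcot1 t).
Proof.
move=> s0; rewrite /onemcot /onemcot1; derive_eq => //.
have -> : t - sin t * cos t = t * (cos t ^+ 2 + sin t ^+ 2) - sin t * cos t.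
  by rewrite cos2Dsin2 mulr1.
by field.
Qed.

Lemma onemcot1_Riccati t : t != 0 -> sin t != 0 ->
  onemcot1 t = (t ^+ 2 - onemcot t + onemcot t ^+ 2) / t.
Proof.
move=> t0 s0; have E := sqr_div_sin s0.
have -> : t ^+ 2 - onemcot t + onemcot t ^+ 2 = (t / sin t) ^+ 2 - (1 - onemcot t).
  by rewrite E; ring.
by rewrite /onemcot1 /onemcot subKr; field; rewrite t0 s0.
Qed.

Lemma is_derive_onemcot1 t : sin t != 0 ->
  is_derive t 1 onemcot1 (2 * onemcot t / sin t ^+ 2).
Proof.
move=> s0; rewrite /onemcot /onemcot1; derive_eq; first by rewrite expf_neq0.
rewrite /=.
have -> : 1 - (sin t * - sin t + cos t * cos t) = 2 * sin t ^+ 2.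
  by have := cos2Dsin2 t; nra.
rewrite -[X in 2 * (X - _)](cos2Dsin2 t).
by field.
Qed.

(** [onemcot] is convex because its second derivative is
    2 (1 - t cot t) / sin^2 t. At t = 0, division by zero gives it the value 1
    instead of the limit 0, and what has to be shown there is
    1 - (r / sin r)^2 <= 1. *)
Lemma onemcot_tangent r t : 0 < r <= pi / 2 -> 0 <= t <= pi / 2 ->
  onemcot r + onemcot1 r * (t - r) <= onemcot t.
Proof.
move=> rI /andP[t0 tpi]; have [r0 rpi] := andP rI.
move: t0; rewrite le_eqVlt => /predU1P[<-|t0].
  have s0 := sin_gt0_pihalf_le rI.
  have -> : onemcot r + onemcot1 r * (0 - r) = 1 - (r / sin r) ^+ 2.
    by rewrite /onemcot /onemcot1; field; rewrite gt_eqF.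
  have -> : onemcot 0 = 1 :> R by rewrite /onemcot !mul0r subr0.
  by rewrite gerBl exprn_ge0// divr_ge0// ltW.
pose a := Num.min r t.
have aI z : a <= z <= pi / 2 -> 0 < z <= pi / 2.
  move=> /andP[az ->]; rewrite andbT.
  by move: az; rewrite /a ge_min => /orP[]; apply: lt_le_trans.
apply: (@convex_tangent _ onemcot onemcot1 (fun z => 2 * onemcot z / sin z ^+ 2)
  a (pi / 2)).
- by move=> z /aI zI; apply: is_derive_onemcot; rewrite gt_eqF// sin_gt0_pihalf_le.
- by move=> z /aI zI; apply: is_derive_onemcot1; rewrite gt_eqF// sin_gt0_pihalf_le.
- move=> z /aI zI; rewrite mulr_ge0// ?invr_ge0 ?exprn_ge0//.
    by rewrite mulr_ge0// ltW// onemcot_gt0.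
  by rewrite ltW// sin_gt0_pihalf_le.
- by rewrite ge_min lexx.
- by rewrite ge_min lexx orbT.
Qed.

Definition sqr_onemcot t : R := t ^+ 2 / onemcot t.

(** The derivative of [sqr_onemcot], by the Riccati equation of [onemcot]. *)
Definition sqr_onemcot1 t : R :=
  (3 * sqr_onemcot t - sqr_onemcot t ^+ 2 - t ^+ 2) / t.

(** The derivative of [sqr_onemcot1], by differentiating
    t G' = 3 G - G^2 - t^2. *)
Definition sqr_onemcot2 t : R :=
  (2 * sqr_onemcot1 t * (1 - sqr_onemcot t) - 2 * t) / t.

Lemma is_derive_sqr_onemcot t : 0 < t <= pi / 2 ->
  is_derive t 1 sqr_onemcot (sqr_onemcot1 t).
Proof.
move=> tI; have m0 := onemcot_gt0 tI.
have s0 : sin t != 0 by rewrite gt_eqF// sin_gt0_pihalf_le.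
have t0 : t != 0 by rewrite gt_eqF//; case/andP: tI.
apply: is_derive_eq (is_derive_div (negbT (gt_eqF m0))
  (is_derive_exp 2 (is_derive_var t)) (is_derive_onemcot s0)) _.
rewrite /= (onemcot1_Riccati t0 s0) /sqr_onemcot1 /sqr_onemcot.
by field; rewrite t0 gt_eqF.
Qed.

Lemma is_derive_sqr_onemcot1 t : 0 < t <= pi / 2 ->
  is_derive t 1 sqr_onemcot1 (sqr_onemcot2 t).
Proof.
move=> tI.
have t0 : t != 0 by rewrite gt_eqF//; case/andP: tI.
have dG := is_derive_sqr_onemcot tI.
apply: is_derive_eq (is_derive_div t0 (is_derive_sub (is_derive_sub
  (is_derive_mul (is_derive_const 3 t) dG) (is_derive_exp 2 dG))
  (is_derive_exp 2 (is_derive_var t))) (is_derive_var t)) _.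
rewrite /= /sqr_onemcot2 [sqr_onemcot1]lock /= -lock.
have -> : 3 * sqr_onemcot t - sqr_onemcot t ^+ 2 - t ^+ 2 = sqr_onemcot1 t * t.
  by rewrite /sqr_onemcot1; field.
by field.
Qed.

(** Up to a positive factor, - G'' is G (G - 1) (3 - G) - t^2 (G - 2). If G <= 2
    both terms are nonnegative. If G > 2, the bound t^2 <= 6 (3 - G) leaves
    (3 - G) times G (G - 1) - 6 (G - 2) = (3 - G) (4 - G). *)
Lemma sqr_onemcot2_le0 t : 0 < t <= pi / 2 -> sqr_onemcot2 t <= 0.
Proof.
move=> tI; have m0 := onemcot_gt0 tI; have [t0 tpi] := andP tI.
set G := sqr_onemcot t.
have G1 : 1 <= G by rewrite ler_pdivlMr// mul1r onemcot_le_sqr.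
have G3 : t ^+ 2 <= 6 * (3 - G).
  have : 6 * G <= 18 - t ^+ 2.
    by rewrite mulrA ler_pdivrMr// onemcot_ge_rational.
  lra.
rewrite /sqr_onemcot2 /sqr_onemcot1 -/G; clearbody G.
have -> : (2 * ((3 * G - G ^+ 2 - t ^+ 2) / t) * (1 - G) - 2 * t) / t =
  - (2 * (G * (G - 1) * (3 - G) - t ^+ 2 * (G - 2)) / t ^+ 2).
  by field; rewrite gt_eqF.
rewrite oppr_le0 divr_ge0 ?exprn_ge0 ?(ltW t0)// mulr_ge0//.
have t2 : 0 <= t ^+ 2 by rewrite exprn_ge0// ltW.
have [G2|G2] := leP G 2.
  have : 0 <= G * (G - 1) * (3 - G) by rewrite !mulr_ge0//; lra.
  have : 0 <= t ^+ 2 * (2 - G) by rewrite mulr_ge0//; lra.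
  lra.
have : t ^+ 2 * (G - 2) <= 6 * (3 - G) * (G - 2) by rewrite ler_pM2r; lra.
have : 0 <= (3 - G) ^+ 2 * (4 - G).
  by rewrite mulr_ge0 ?sqr_ge0//; lra.
lra.
Qed.

(** The tangent inequality at r for G = [sqr_onemcot], cleared of denominators.
    With n = 1 - r cot r and N = (r / sin r)^2 - 1, the slope of the tangent is
    r (n - N) / n^2. *)
Lemma sqr_onemcot_tangent r t : 0 < r <= pi / 2 -> 0 < t <= pi / 2 ->
  t ^+ 2 * onemcot r ^+ 2 <= onemcot t *
    (((r / sin r) ^+ 2 - 1) * r ^+ 2 -
     ((r / sin r) ^+ 2 - 1 - onemcot r) * (r * t)).
Proof.
move=> rI tI; set N := _ - 1; set n := onemcot r; have m0 := onemcot_gt0 tI.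
have n0 : 0 < n := onemcot_gt0 rI.
have [r0 rpi] := andP rI; have [t0 tpi] := andP tI.
pose a := Num.min r t.
have aI z : a <= z <= pi / 2 -> 0 < z <= pi / 2.
  move=> /andP[az ->]; rewrite andbT.
  by move: az; rewrite /a ge_min => /orP[]; apply: lt_le_trans.
have : (- sqr_onemcot r) + (- sqr_onemcot1 r) * (t - r) <= - sqr_onemcot t.
  apply: (@convex_tangent _ (fun z => - sqr_onemcot z) (fun z => - sqr_onemcot1 z)
     (fun z => - sqr_onemcot2 z) a (pi / 2)).
  - by move=> z /aI zI; apply: is_deriveN; exact: is_derive_sqr_onemcot.
  - by move=> z /aI zI; apply: is_deriveN; exact: is_derive_sqr_onemcot1.
  - by move=> z /aI zI; rewrite oppr_ge0 sqr_onemcot2_le0.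
  - by rewrite ge_min lexx.
  - by rewrite ge_min lexx orbT.
have s0 : sin r != 0 by rewrite gt_eqF// sin_gt0_pihalf_le.
have E : N = r ^+ 2 + (1 - n) ^+ 2 - 1 by rewrite /N sqr_div_sin.
rewrite /sqr_onemcot1 /sqr_onemcot -/n => H.
have : t ^+ 2 / onemcot t <= (N * r ^+ 2 - (N - n) * (r * t)) / n ^+ 2.
  suff -> : (N * r ^+ 2 - (N - n) * (r * t)) / n ^+ 2 =
    r ^+ 2 / n + (3 * (r ^+ 2 / n) - (r ^+ 2 / n) ^+ 2 - r ^+ 2) / r * (t - r) by lra.
  by rewrite E; field; rewrite gt_eqF// gt_eqF.
by rewrite ler_pdivrMr// mulrAC ler_pdivlMr ?exprn_gt0// [onemcot t * _]mulrC.
Qed.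

(** In the notation of [sqr_onemcot_tangent] this is n <= N: the slope of the
    tangent is nonpositive. *)
Lemma onemcot_le_sqr_sin r : 0 < r <= pi / 2 ->
  onemcot r <= (r / sin r) ^+ 2 - 1.
Proof.
move=> rI; have s0 := sin_gt0_pihalf_le rI; have [r0 rpi] := andP rI.
have := @le_sin_sqr R r; rewrite (ltW r0) rpi => /(_ isT) H.
rewrite -subr_ge0 /onemcot.
have -> : (r / sin r) ^+ 2 - 1 - (1 - r * cos r / sin r) =
   (r ^+ 2 + r * sin r * cos r - 2 * sin r ^+ 2) / sin r ^+ 2.
  by field; rewrite gt_eqF.
by apply: divr_ge0; [rewrite subr_ge0|rewrite exprn_ge0// ltW].
Qed.

End cotangent.

(** * Cross-curvature of the sphere *)

(** The cross-curvature of the sphere as a quadratic form in the direction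
    (C, S) of a line in the tangent plane at the base point, where S is the
    radial component. Here r is the distance from the base point to the moving
    point, th the distance from the moving point to the third point, and (p, q)
    the direction of the third point seen from the moving point;
    m = 1 - th cot th, n = 1 - r cot r, k = sin r / r and N + 1 = 1 / k^2.
    Up to the factor m the form dominates the square of m q S - k T C,
    with T as in the proof. *)
Lemma cross_curvature_form (R : realFieldType)
    (m n N k p q r th S C : R) :
  0 < m -> 0 < r -> 0 < th ->
  k ^+ 2 * (N + 1) = 1 -> p ^+ 2 + q ^+ 2 <= 1 -> n <= N ->
  th ^+ 2 * n ^+ 2 <= m * (N * r ^+ 2 - (N - n) * (r * th)) ->
  0 <= S ^+ 2 * (m * (1 - p ^+ 2))
       - 2 * (S * C) * (k * q * (th * n / r + m * p))
       + C ^+ 2 * (1 - (1 - m) * k ^+ 2 + th * p * (1 - k ^+ 2 * (1 - n)) / r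
                   - m * k ^+ 2 * q ^+ 2).
Proof.
move=> m0 r0 th0 kN pq nN key.
set T := th * n / r + m * p; set Z := 1 - _ + _ - _.
have q1 : q ^+ 2 <= 1 - p ^+ 2 by lra.
have p1 : - 1 <= p.
  have : 0 <= q ^+ 2 by exact: sqr_ge0.
  by nra.
(* After replacing q^2 by its largest value 1 - p^2 the difference is affine and
   nondecreasing in p, so that p = -1 is the worst case; there it is [key]. *)
have mZ : k ^+ 2 * T ^+ 2 <= m * Z.
  have k2 : 0 <= k ^+ 2 by exact: sqr_ge0.
  have : 0 <= m ^+ 2 * k ^+ 2 * (1 - p ^+ 2 - q ^+ 2).
    by rewrite mulr_ge0 ?subr_ge0// mulr_ge0// exprn_ge0// ltW.
  have : 0 <= k ^+ 2 * (m * (th / r) * (N - n)) * (1 + p).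
    have thr : 0 <= th / r by rewrite divr_ge0// ltW.
    have p10 : 0 <= 1 + p by lra.
    by rewrite mulr_ge0// mulr_ge0// mulr_ge0 ?subr_ge0// mulr_ge0// ltW.
  have : 0 <= k ^+ 2 * (m * (N * r ^+ 2 - (N - n) * (r * th)) - th ^+ 2 * n ^+ 2) / r ^+ 2.
    by rewrite divr_ge0 ?exprn_ge0 ?(ltW r0)// mulr_ge0// subr_ge0.
  suff -> : m * Z = k ^+ 2 * T ^+ 2 + m ^+ 2 * k ^+ 2 * (1 - p ^+ 2 - q ^+ 2)
    + k ^+ 2 * (m * (th / r) * (N - n)) * (1 + p)
    + k ^+ 2 * (m * (N * r ^+ 2 - (N - n) * (r * th)) - th ^+ 2 * n ^+ 2) / r ^+ 2.
    by lra.
  have -> : Z = k ^+ 2 * (N + 1) - (1 - m) * k ^+ 2 +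
      th * p * (k ^+ 2 * (N + 1) - k ^+ 2 * (1 - n)) / r - m * k ^+ 2 * q ^+ 2.
    by rewrite kN.
  by rewrite /T; field; rewrite gt_eqF.
rewrite -(pmulr_rge0 _ m0).
apply: le_trans (sqr_ge0 (m * q * S - k * T * C)) _.
have : 0 <= C ^+ 2 * (m * Z - k ^+ 2 * T ^+ 2).
  by rewrite mulr_ge0 ?sqr_ge0// subr_ge0.
have : 0 <= (m * S) ^+ 2 * (1 - p ^+ 2 - q ^+ 2).
  by rewrite mulr_ge0 ?sqr_ge0//; lra.
clearbody T Z.
suff -> : m * (S ^+ 2 * (m * (1 - p ^+ 2)) - 2 * (S * C) * (k * q * T) + C ^+ 2 * Z) =
   (m * q * S - k * T * C) ^+ 2 + (m * S) ^+ 2 * (1 - p ^+ 2 - q ^+ 2) +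
   C ^+ 2 * (m * Z - k ^+ 2 * T ^+ 2) by lra.
by ring.
Qed.

Section acos_sqr.
Context {R : realType}.
Implicit Types s t x y z : R.

(** Half the second derivative of s^2 - acos(u(s))^2, in terms of the values
    [v], [v1], [v2] of u, u', u''. *)
Definition acos_sqr_hess (v v1 v2 : R) : R :=
  1 + acos v / sin (acos v) * v2 - onemcot (acos v) * (v1 / sin (acos v)) ^+ 2.

Lemma sin_acos_gt0 (v : R) : -1 < v < 1 -> 0 < sin (acos v).
Proof.
move=> /andP[v1 v2]; apply: sin_gt0_pi.
by rewrite acos_gt0 ?acos_ltpi// ?v1 ?v2 ltW.
Qed.

Lemma sqr_sub_acos_sqr_convex (u u1 u2 : R -> R) a b :
  (forall z, a <= z <= b -> is_derive z 1 u (u1 z)) ->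
  (forall z, a <= z <= b -> is_derive z 1 u1 (u2 z)) ->
  (forall z, a <= z <= b -> -1 < u z < 1) ->
  (forall z, a <= z <= b -> 0 <= acos_sqr_hess (u z) (u1 z) (u2 z)) ->
  forall x y t z, a <= x <= b -> a <= y <= b -> 0 <= t <= 1 ->
  z = (1 - t) * x + t * y ->
  z ^+ 2 - acos (u z) ^+ 2 <=
  (1 - t) * (x ^+ 2 - acos (u x) ^+ 2) + t * (y ^+ 2 - acos (u y) ^+ 2).
Proof.
move=> du du1 uI hess x y t z xI yI /andP[t0 t1] zE.
have zI : a <= z <= b by rewrite zE conv_itv// t0.
pose th s := acos (u s).
have dth s : a <= s <= b -> is_derive s 1 th (- (u1 s / sin (th s))).
  move=> sI; have := is_derive1_acos (uI _ sI).
  rewrite -sin_acos; last by have /andP[? ?] := uI _ sI; rewrite !ltW.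
  move=> H; apply: is_derive_eq (is_derive_chain (du _ sI) H) _.
  by rewrite mulNr mulrC.
have s0 s : a <= s <= b -> sin (th s) != 0.
  by move=> /uI /sin_acos_gt0; rewrite /th => /gt_eqF ->.
pose f s := s ^+ 2 - th s ^+ 2.
pose f1 s := 2 * s + 2 * (th s / sin (th s) * u1 s).
pose f2 s := 2 * acos_sqr_hess (u s) (u1 s) (u2 s).
have df s : a <= s <= b -> is_derive s 1 f (f1 s).
  move=> sI; have s0' := s0 _ sI.
  apply: is_derive_eq (is_derive_sub (is_derive_exp 2 (is_derive_var s))
    (is_derive_exp 2 (dth _ sI))) _.
  by rewrite /f1 /=; field.
have df1 s : a <= s <= b -> is_derive s 1 f1 (f2 s).
  move=> sI; have s0' := s0 _ sI.
  have dsin := is_derive_chain (dth _ sI) (is_derive_sin (th s)).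
  apply: is_derive_eq (is_derive_add
    (is_derive_mul (is_derive_const 2 s) (is_derive_var s))
    (is_derive_mul (is_derive_const 2 s) (is_derive_mul
       (is_derive_div s0' (dth _ sI) dsin) (du1 _ sI)))) _.
  by rewrite /f2 /acos_sqr_hess /onemcot -/(th s) /=; field.
have tg v : a <= v <= b -> f z + f1 z * (v - z) <= f v.
  move=> vI; apply: (convex_tangent df df1) zI vI => s sI.
  by rewrite /f2 mulr_ge0// hess.
have H1 : 0 <= (1 - t) * (f x - (f z + f1 z * (x - z))).
  by rewrite mulr_ge0 ?subr_ge0 ?tg.
have H2 : 0 <= t * (f y - (f z + f1 z * (y - z))).
  by rewrite mulr_ge0 ?subr_ge0 ?tg.
rewrite -/(th _) -/(th _) -/(th _) -/(f _) -/(f _) -/(f _).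
have : (1 - t) * (x - z) + t * (y - z) = 0 by rewrite zE; ring.
move=> /(congr1 (fun w => f1 z * w)); rewrite mulr0.
by clearbody f f1 f2; lra.
Qed.

End acos_sqr.

(** [cross_curvature_form] in coordinates: al, be, ga are the components of the
    third point on the base point and on orthonormal tangent vectors e1, e2, the
    line being parallel to e2. The moving point is at distance r from the base
    point in the direction C e1 + S e2, with c = cos r and k = sin r / r; u is
    its inner product with the third point, th their angle and si the sine of
    th. The formulas for u1 and u2 are the derivatives of u along the line. *)
Lemma sphere_hess_ge0 (R : realFieldType)
    (th si u m n N r k c C S al be ga u1 u2 : R) :
  C ^+ 2 + S ^+ 2 = 1 -> c ^+ 2 + (k * r) ^+ 2 = 1 ->
  0 < si -> u ^+ 2 + si ^+ 2 = 1 -> al ^+ 2 + be ^+ 2 + ga ^+ 2 <= 1 ->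
  u = al * c + k * r * (C * be + S * ga) ->
  0 < m -> m = 1 - th * u / si -> c = k * (1 - n) ->
  0 < r -> 0 < th -> k ^+ 2 * (N + 1) = 1 -> n <= N ->
  th ^+ 2 * n ^+ 2 <= m * (N * r ^+ 2 - (N - n) * (r * th)) ->
  u1 = - al * (k * r * S) + S * (c - k) * (C * be + S * ga) + k * ga ->
  u2 = - al * (k + S ^+ 2 * (c - k)) +
    ((c - k) * (1 - 3 * S ^+ 2) - S ^+ 2 * k * r ^+ 2) / r * (C * be + S * ga)
    + 2 * S * (c - k) / r * ga ->
  0 <= 1 + th / si * u2 - m * (u1 / si) ^+ 2.
Proof.
move=> CS1 ck1 si0 us1 abc1 uE m0 mE cE r0 th0 kN nN key u1E u2E.
(* [P] and [Q] are the components of the third point on the radial and the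
   transversal unit tangent vectors at the moving point. *)
pose l := C * be + S * ga.
pose P := - (k * r) * al + c * l.
pose Q := - S * be + C * ga.
have PQ : P ^+ 2 + Q ^+ 2 <= si ^+ 2.
  suff : u ^+ 2 + P ^+ 2 + Q ^+ 2 = al ^+ 2 + be ^+ 2 + ga ^+ 2 by lra.
  have -> : u ^+ 2 + P ^+ 2 + Q ^+ 2 =
    (c ^+ 2 + (k * r) ^+ 2) * (al ^+ 2 + l ^+ 2) + Q ^+ 2.
    by rewrite uE /P /l; ring.
  rewrite ck1 mul1r.
  have -> : al ^+ 2 + l ^+ 2 + Q ^+ 2 =
    al ^+ 2 + (C ^+ 2 + S ^+ 2) * (be ^+ 2 + ga ^+ 2) by rewrite /l /Q; ring.
  by rewrite CS1; ring.
have u1P : u1 = P * S + k * C * Q.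
  have -> : u1 = P * S + k * C * Q + k * ga * (1 - (C ^+ 2 + S ^+ 2)).
    by rewrite u1E /P /Q /l; ring.
  by rewrite CS1; ring.
have u2P : u2 = - (S ^+ 2 + k ^+ 2 * C ^+ 2) * u + P * C ^+ 2 * (1 - k * c) / r
    - 2 * Q * S * C * (k - c) / r.
  have -> : u2 = - (S ^+ 2 + k ^+ 2 * C ^+ 2) * u + P * C ^+ 2 * (1 - k * c) / r
    - 2 * Q * S * C * (k - c) / r
    + (1 - (C ^+ 2 + S ^+ 2)) * (- k * al + (c - k) / r * (l + 2 * S * ga))
    - k * C ^+ 2 * l / r * (1 - (c ^+ 2 + (k * r) ^+ 2)).
    by rewrite u2E uE /P /Q /l; field; rewrite gt_eqF.
  by rewrite CS1 ck1; ring.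
pose p := P / si; pose q := Q / si.
have pE : P = si * p by rewrite /p; field; rewrite gt_eqF.
have qE : Q = si * q by rewrite /q; field; rewrite gt_eqF.
have pq : p ^+ 2 + q ^+ 2 <= 1.
  by rewrite /p /q !expr_div_n -mulrDl ler_pdivrMr ?exprn_gt0// mul1r.
have muE : th * u / si = 1 - m by rewrite mE; ring.
have := @cross_curvature_form R m n N k p q r th S C m0 r0 th0 kN pq nN key.
congr (_ <= _).
have -> : th / si * u2 = - (S ^+ 2 + k ^+ 2 * C ^+ 2) * (th * u / si) +
   th * (p * C ^+ 2 * (1 - k * c) / r - 2 * q * S * C * (k - c) / r).
  by rewrite u2P pE qE; field; rewrite !gt_eqF.
have -> : u1 / si = p * S + k * C * q.
  by rewrite u1P pE qE; field; rewrite gt_eqF.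
rewrite muE cE -[X in _ = X + _ - _]CS1.
by field; rewrite gt_eqF.
Qed.

(** * Convexity along lines in a tangent plane *)

Section great_circles.
Context {R : realType}.
Implicit Types s x y z : R.

Lemma acos_le_pihalf x : 0 <= x <= 1 -> acos x <= pi / 2.
Proof.
move=> /andP[x0 x1]; have pi0 := @pi_gt0 R.
have xN : -1 <= x <= 1 by rewrite x1 andbT; lra.
rewrite leNgt -ltr_cos ?in_itv/= ?acos_ge0 ?acos_lepi//; last by lra.
by rewrite cos_pihalf acosK ?in_itv//= -leNgt.
Qed.

(** The inner product of the unit vector with coordinates [al], [be], [ga] with
    the exponential, at the first basis vector, of the tangent vector with
    coordinates [a] and [s]. *)
Definition sphere_exp (al be ga a s : R) : R :=
  let r := Num.sqrt (a ^+ 2 + s ^+ 2) in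
  al * cos r + sin r / r * (a * be + s * ga).

(** Since the line misses the origin and the third point lies strictly inside
    the ball, no square root or arc cosine is differentiated at a singular
    point. *)
Lemma sphere_exp_convex_generic (al be ga a b0 b1 : R) :
  0 < a -> al ^+ 2 + be ^+ 2 + ga ^+ 2 < 1 ->
  (forall z, b0 <= z <= b1 -> Num.sqrt (a ^+ 2 + z ^+ 2) <= pi / 2) ->
  (forall z, b0 <= z <= b1 -> 0 <= sphere_exp al be ga a z) ->
  forall x y t z, b0 <= x <= b1 -> b0 <= y <= b1 -> 0 <= t <= 1 ->
  z = (1 - t) * x + t * y ->
  z ^+ 2 - acos (sphere_exp al be ga a z) ^+ 2 <=
  (1 - t) * (x ^+ 2 - acos (sphere_exp al be ga a x) ^+ 2) +
  t * (y ^+ 2 - acos (sphere_exp al be ga a y) ^+ 2).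
Proof.
move=> a0 h1 rpi u0.
pose r z := Num.sqrt (a ^+ 2 + z ^+ 2).
have q0 z : 0 < a ^+ 2 + z ^+ 2 by rewrite ltr_wpDr ?sqr_ge0 ?exprn_gt0.
have r0 z : 0 < r z by rewrite sqrtr_gt0.
have rn0 z : r z != 0 by rewrite gt_eqF.
have r2 z : r z ^+ 2 = a ^+ 2 + z ^+ 2 by rewrite sqr_sqrtr// ltW.
pose c z := cos (r z).
pose k z := sin (r z) / r z.
pose w z := (c z - k z) / r z ^+ 2.
pose l z := a * be + z * ga.
have dr z : is_derive z 1 r (z / r z).
  have dq : is_derive z 1 (fun z => a ^+ 2 + z ^+ 2) (2 * z).
    by derive_eq; ring.
  apply: is_derive_eq (is_derive_chain dq (is_derive1_sqrt (q0 z))) _.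
  by rewrite -/(r z); field.
have dc z : is_derive z 1 c (- (k z * z)).
  have H := is_derive_chain (dr z) (is_derive_cos (r z)).
  apply: is_derive_eq H _.
  by rewrite /k; field.
have dk z : is_derive z 1 k (z * w z).
  have H := is_derive_chain (dr z) (is_derive_sin (r z)).
  apply: is_derive_eq (is_derive_div (rn0 z) H (dr z)) _.
  by rewrite /w /k /c; field.
have dl z : is_derive z 1 l ga by rewrite /l; derive_eq; ring.
pose w1 z := z * (- k z - 3 * w z) / r z ^+ 2.
have dw z : is_derive z 1 w (w1 z).
  apply: is_derive_eq (is_derive_div (g := fun z => r z ^+ 2) (expf_neq0 2 (rn0 z))
     (is_derive_sub (dc z) (dk z)) (is_derive_exp 2 (dr z))) _.
  by rewrite /w1 /= /w; field.
pose u1 z := - al * (k z * z) + (z * w z * l z + k z * ga).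
have du z : is_derive z 1 (sphere_exp al be ga a) (u1 z).
  apply: is_derive_eq (is_derive_add
    (is_derive_mul (is_derive_const al z) (dc z))
    (is_derive_mul (dk z) (dl z))) _.
  by rewrite /u1; ring.
pose u2 z := - al * (k z + z ^+ 2 * w z) + (w z + z * w1 z) * l z + 2 * z * w z * ga.
have du1 z : is_derive z 1 u1 (u2 z).
  apply: is_derive_eq (is_derive_add
    (is_derive_mul (is_derive_const (- al) z) (is_derive_mul (dk z) (is_derive_var z)))
    (is_derive_add (is_derive_mul (is_derive_mul (is_derive_var z) (dw z)) (dl z))
       (is_derive_mul (dk z) (is_derive_const ga z)))) _.
  by rewrite /u2; ring.
have CS1 z : (a / r z) ^+ 2 + (z / r z) ^+ 2 = 1.
  by rewrite !expr_div_n -mulrDl -r2 divff// expf_neq0.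
have ck1 z : c z ^+ 2 + (k z * r z) ^+ 2 = 1.
  by rewrite /k divfK// cos2Dsin2.
have uE z : sphere_exp al be ga a z =
    al * c z + k z * r z * (a / r z * be + z / r z * ga).
  by rewrite /sphere_exp -/(r z) /c /k; field.
have u1' z : sphere_exp al be ga a z ^+ 2 < 1.
  rewrite uE; set C := a / r z; set S := z / r z.
  apply: le_lt_trans h1.
  have -> : al ^+ 2 + be ^+ 2 + ga ^+ 2 =
    (c z ^+ 2 + (k z * r z) ^+ 2) * (al ^+ 2 + (C ^+ 2 + S ^+ 2) * (be ^+ 2 + ga ^+ 2)).
    by rewrite ck1 CS1; ring.
  rewrite -subr_ge0.
  have -> : (c z ^+ 2 + (k z * r z) ^+ 2) * (al ^+ 2 + (C ^+ 2 + S ^+ 2) * (be ^+ 2 + ga ^+ 2))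
    - (al * c z + k z * r z * (C * be + S * ga)) ^+ 2 =
    (k z * r z * al - c z * (C * be + S * ga)) ^+ 2 +
    (c z ^+ 2 + (k z * r z) ^+ 2) * (S * be - C * ga) ^+ 2 by ring.
  by rewrite ck1 mul1r addr_ge0 ?sqr_ge0.
have uI z : b0 <= z <= b1 -> -1 < sphere_exp al be ga a z < 1.
  move=> /u0 uz; have := u1' z; set v := sphere_exp _ _ _ _ _ in uz *.
  by move=> v1; apply/andP; split; [lra|nra].
apply: (sqr_sub_acos_sqr_convex (u1 := u1) (u2 := u2)) => //.
move=> z zI.
have si0 := sin_acos_gt0 (uI _ zI).
have uN1 : -1 <= sphere_exp al be ga a z <= 1.
  by have /andP[? ?] := uI _ zI; rewrite !ltW.
have cosE : cos (acos (sphere_exp al be ga a z)) = sphere_exp al be ga a z.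
  by rewrite acosK// in_itv.
have thI : 0 < acos (sphere_exp al be ga a z) <= pi / 2.
  have /andP[uN u1z] := uI _ zI; rewrite acos_gt0 ?(ltW uN) ?u1z//=.
  by rewrite acos_le_pihalf// u0// ltW.
have rI : 0 < r z <= pi / 2 by rewrite r0 rpi.
have sr0 := sin_gt0_pihalf_le rI.
set u := sphere_exp al be ga a z in uN1 si0 thI cosE *.
rewrite /acos_sqr_hess.
apply: (@sphere_hess_ge0 R (acos u) (sin (acos u)) u (onemcot (acos u))
  (onemcot (r z)) ((r z / sin (r z)) ^+ 2 - 1) (r z) (k z) (c z)
  (a / r z) (z / r z) al be ga) => //.
- by rewrite -[X in X ^+ 2 + _]cosE cos2Dsin2.
- exact: ltW.
- exact: uE.
- exact: onemcot_gt0.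
- by rewrite /onemcot cosE.
- by rewrite /onemcot /k /c; field; rewrite rn0 gt_eqF.
- by case/andP: thI.
- by rewrite /k; field; rewrite rn0 gt_eqF.
- exact: onemcot_le_sqr_sin.
- exact: sqr_onemcot_tangent.
- by rewrite /u1 /w /l; field.
- by rewrite /u2 /w1 /w /l; field.
Qed.

End great_circles.

Section sphere_convexity.
Context {R : realType}.
Implicit Types s t x y z : R.

(** For a line through the origin the moving point runs on a great circle at
    unit speed, so that u'' = - u and the quadratic form reduces to
    (1 - th cot th) (1 - (u' / sin th)^2). *)
Lemma sphere_exp_convex_meridian (al be ga b0 b1 : R) :
  al ^+ 2 + ga ^+ 2 < 1 ->
  (forall z, b0 <= z <= b1 -> 0 <= sphere_exp al be ga 0 z) ->
  forall x y t z, b0 <= x <= b1 -> b0 <= y <= b1 -> 0 <= t <= 1 ->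
  z = (1 - t) * x + t * y ->
  z ^+ 2 - acos (sphere_exp al be ga 0 z) ^+ 2 <=
  (1 - t) * (x ^+ 2 - acos (sphere_exp al be ga 0 x) ^+ 2) +
  t * (y ^+ 2 - acos (sphere_exp al be ga 0 y) ^+ 2).
Proof.
move=> h1.
pose u z := al * cos z + ga * sin z.
have -> : sphere_exp al be ga 0 = u.
  apply/funext => z; rewrite /sphere_exp expr0n add0r sqrtr_sqr cos_norm mul0r add0r.
  rewrite /u; congr (_ + _).
  have [->|z0] := eqVneq z 0; first by rewrite mul0r mulr0 sin0 mulr0.
  have [zp|zn] := leP 0 z.
    by rewrite ger0_norm//; field.
  by rewrite ltr0_norm// sinN; field.
move=> u0.
pose u1 z := - al * sin z + ga * cos z.
have du z : is_derive z 1 u (u1 z) by rewrite /u /u1; derive_eq; ring.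
have du1 z : is_derive z 1 u1 (- u z) by rewrite /u /u1; derive_eq; ring.
have uu z : u z ^+ 2 + u1 z ^+ 2 < 1.
  have -> : u z ^+ 2 + u1 z ^+ 2 = (cos z ^+ 2 + sin z ^+ 2) * (al ^+ 2 + ga ^+ 2).
    by rewrite /u /u1; ring.
  by rewrite cos2Dsin2 mul1r.
have uI z : b0 <= z <= b1 -> -1 < u z < 1.
  move=> /u0 uz; have := uu z; have : 0 <= u1 z ^+ 2 by exact: sqr_ge0.
  by move=> *; apply/andP; split; [lra|nra].
apply: (sqr_sub_acos_sqr_convex (u1 := u1) (u2 := fun z => - u z)) => //.
move=> z zI; have si0 := sin_acos_gt0 (uI _ zI).
have /andP[uN u1z] := uI _ zI.
have uN1 : -1 <= u z <= 1 by rewrite !ltW.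
have cosE : cos (acos (u z)) = u z by rewrite acosK// in_itv.
have thI : 0 < acos (u z) <= pi / 2.
  by rewrite acos_gt0 ?(ltW uN) ?u1z//= acos_le_pihalf// u0// ltW.
rewrite /acos_sqr_hess; set th := acos (u z) in si0 cosE thI *.
have -> : 1 + th / sin th * - u z - onemcot th * (u1 z / sin th) ^+ 2 =
  onemcot th * (1 - (u1 z / sin th) ^+ 2).
  by rewrite /onemcot cosE; field; rewrite gt_eqF.
rewrite mulr_ge0//; first exact/ltW/onemcot_gt0.
rewrite subr_ge0 expr_div_n ler_pdivrMr ?exprn_gt0// mul1r.
by have := uu z; have := cos2Dsin2 th; rewrite cosE; lra.
Qed.

(** The case u = 1 is needed when the path passes through the third point. *)
Lemma cvg_acos_left (u : R) : 0 <= u <= 1 ->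
  acos (t * u) @[t --> 1^'-] --> acos u.
Proof.
move=> /andP[u0]; rewrite le_eqVlt => /predU1P[->|u1].
  rewrite acos1; apply/cvgrPdist_lt => e e0.
  pose e' : R := Num.min e (pi / 2).
  have pi0 := @pi_gt0 R.
  have e'0 : 0 < e' by rewrite lt_min e0/=; lra.
  have e'pi : e' <= pi / 2 by rewrite ge_min lexx orbT.
  have ce1 : cos e' < 1.
    by rewrite -cos0 ltr_cos// in_itv/=; apply/andP; split; lra.
  have ce0 : 0 <= cos e' by apply: cos_ge0_pihalf; lra.
  near=> t.
  have t1 : t < 1 by near: t; exact: nbhs_left_lt.
  have te : cos e' < t by near: t; exact: nbhs_left_gt.
  rewrite mulr1 sub0r normrN ger0_norm; last by rewrite acos_ge0//; lra.
  have tN : -1 <= t <= 1 by apply/andP; split; lra.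
  apply: (@lt_le_trans _ _ e'); last by rewrite ge_min lexx.
  rewrite -ltr_cos ?in_itv/=.
  - by rewrite acosK// in_itv.
  - by rewrite acos_ge0// acos_lepi.
  - by apply/andP; split; lra.
have H : acos (t * u) @[t --> (1:R)] --> acos (1 * u).
  apply: (@cvg_comp _ _ _ (fun t : R => t * u) acos _ (nbhs (1 * u))); last first.
    by rewrite mul1r; apply: continuous_acos; rewrite u1 andbT; lra.
  by apply: cvgMl; exact: cvg_id.
by rewrite mul1r in H; exact: cvg_at_left_filter.
Unshelve. all: by end_near. Qed.

(** The third point is shrunk by a factor e < 1; the inequality only involves
    values, so it survives the limit. *)
Lemma sphere_exp_convex (al be ga a b0 b1 : R) :
  0 <= a -> al ^+ 2 + be ^+ 2 + ga ^+ 2 <= 1 ->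
  (forall z, b0 <= z <= b1 -> Num.sqrt (a ^+ 2 + z ^+ 2) <= pi / 2) ->
  (forall z, b0 <= z <= b1 -> 0 <= sphere_exp al be ga a z <= 1) ->
  forall x y t z, b0 <= x <= b1 -> b0 <= y <= b1 -> 0 <= t <= 1 ->
  z = (1 - t) * x + t * y ->
  z ^+ 2 - acos (sphere_exp al be ga a z) ^+ 2 <=
  (1 - t) * (x ^+ 2 - acos (sphere_exp al be ga a x) ^+ 2) +
  t * (y ^+ 2 - acos (sphere_exp al be ga a y) ^+ 2).
Proof.
move=> a0 h1 rpi u01 x y t z xI yI tI zE.
have zI : b0 <= z <= b1 by rewrite zE conv_itv.
have scale e s : sphere_exp (e * al) (e * be) (e * ga) a s =
    e * sphere_exp al be ga a s.
  by rewrite /sphere_exp; ring.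
set u := sphere_exp al be ga a in u01 *.
pose F e : R := (1 - t) * (x ^+ 2 - acos (e * u x) ^+ 2) +
  t * (y ^+ 2 - acos (e * u y) ^+ 2) - (z ^+ 2 - acos (e * u z) ^+ 2).
have F0 e : 0 <= e -> e < 1 -> 0 <= F e.
  move=> e0 e1; rewrite /F subr_ge0.
  have h2 : (e * al) ^+ 2 + (e * be) ^+ 2 + (e * ga) ^+ 2 < 1.
    rewrite !exprMn -!mulrDr; apply: (@le_lt_trans _ _ (e ^+ 2)).
      by rewrite ler_piMr// sqr_ge0.
    by rewrite expr_lt1.
  have u0 s : b0 <= s <= b1 -> 0 <= sphere_exp (e * al) (e * be) (e * ga) a s.
    by move=> /u01 /andP[us _]; rewrite scale mulr_ge0.
  rewrite -!scale.
  move: a0; rewrite le_eqVlt => /predU1P[aE|a0].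
    rewrite -aE in u0 *.
    apply: (sphere_exp_convex_meridian _ u0 xI yI tI zE).
    by apply: le_lt_trans h2; rewrite lerD2r lerDl sqr_ge0.
  exact: (sphere_exp_convex_generic a0 h2 rpi u0 xI yI tI zE).
suff : 0 <= F 1 by rewrite /F !mul1r subr_ge0.
have cF : F e @[e --> 1^'-] --> F 1.
  have ca s : b0 <= s <= b1 ->
      s ^+ 2 - acos (e * u s) ^+ 2 @[e --> 1^'-] --> s ^+ 2 - acos (1 * u s) ^+ 2.
    move=> sI; apply: cvgB; first exact: cvg_cst.
    by rewrite mul1r expr2; apply: cvgM; apply: cvg_acos_left; apply: u01.
  apply: cvgB; last exact: ca.
  by apply: cvgD; apply: cvgMr; exact: ca.
apply: (cvgr_to_ge cF); near=> e.
by apply: F0; near: e; [exact: nbhs_left_ge|exact: nbhs_left_lt].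
Unshelve. all: by end_near. Qed.

(** A nonnegative quadratic form that vanishes at a vector has that vector in
    its kernel. *)
Lemma gram_psd_cross (q00 D : R) :
  (forall k : R, 0 <= k ^+ 2 * q00 + 2 * k * D) -> D = 0.
Proof.
move=> H; apply/eqP; rewrite -sqrf_eq0 eq_le sqr_ge0 andbT.
have [q0|q0] := eqVneq q00 0.
  by have := H (- D); rewrite q0; lra.
have q0' : 0 < q00.
  by rewrite lt_neqAle eq_sym q0/=; have := H 1; have := H (-1); lra.
have := H (- D / q00).
have -> : (- D / q00) ^+ 2 * q00 + 2 * (- D / q00) * D = - (D ^+ 2 / q00) by field.
by rewrite oppr_ge0 pmulr_lle0// invr_gt0.
Qed.

(** The coordinate-free form of [sphere_exp_convex]. The numbers q00, q01, q11 are
    the inner products of two tangent vectors v0, v1, and al, L0, L1 those of the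
    third point with the base point, v0 and v1. The first hypothesis is the
    Cauchy-Schwarz inequality for the third point, of norm at most 1. It allows
    the four vectors to be treated as if they were in a four-dimensional space:
    an orthonormal basis of the plane of v0, v1 is built with e2 parallel to
    v1 - v0, and the segment becomes part of the line a e1 + s e2. *)
Lemma gram_line_convex (al L0 L1 q00 q01 q11 : R) :
  let Q s := (1 - s) ^+ 2 * q00 + 2 * (s * (1 - s)) * q01 + s ^+ 2 * q11 in
  let u s := al * cos (Num.sqrt (Q s)) +
    sin (Num.sqrt (Q s)) / Num.sqrt (Q s) * ((1 - s) * L0 + s * L1) in
  (forall x y z, (x * al + y * L0 + z * L1) ^+ 2 <=
     x ^+ 2 + (y ^+ 2 * q00 + 2 * (y * z) * q01 + z ^+ 2 * q11)) ->
  (forall s, 0 <= s <= 1 -> Num.sqrt (Q s) <= pi / 2) ->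
  (forall s, 0 <= s <= 1 -> 0 <= u s <= 1) ->
  forall x y t z, 0 <= x <= 1 -> 0 <= y <= 1 -> 0 <= t <= 1 ->
  z = (1 - t) * x + t * y ->
  Q z - acos (u z) ^+ 2 <=
  (1 - t) * (Q x - acos (u x) ^+ 2) + t * (Q y - acos (u y) ^+ 2).
Proof.
move=> Q u CS Qpi u01 x y t z xI yI tI zE.
pose w2 := q00 - 2 * q01 + q11; pose D := q01 - q00; pose l := L1 - L0.
have QE s : Q s = q00 + 2 * s * D + s ^+ 2 * w2 by rewrite /Q /D /w2; ring.
have w20 : 0 <= w2.
  have := CS 0 (-1) 1; have := sqr_ge0 (0 * al + -1 * L0 + 1 * L1).
  by rewrite /w2; lra.
have CSD k : (L1 - L0 + k * L0) ^+ 2 <= k ^+ 2 * q00 + 2 * k * D + w2.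
  have := CS 0 (k - 1) 1; rewrite /D /w2; lra.
(* [w2] is the squared norm of v1 - v0; if it is 0, all is constant. *)
move: w20; rewrite le_eqVlt => /predU1P[w20|w20].
  have D0 : D = 0.
    apply: (@gram_psd_cross q00) => k.
    by have := CSD k; have := sqr_ge0 (L1 - L0 + k * L0); rewrite -w20; lra.
  have l0 : L1 = L0.
    apply/eqP; rewrite -subr_eq0 -sqrf_eq0 eq_le sqr_ge0 andbT.
    by have := CSD 0; rewrite -w20; lra.
  have Qc s : Q s = q00 by rewrite QE D0 -w20; ring.
  have uc s : u s = u 0 by rewrite /u !Qc l0; congr (_ + _ * _); ring.
  by rewrite !Qc (uc z) (uc x) (uc y); lra.
pose tau := Num.sqrt w2.
have tau0 : 0 < tau by rewrite sqrtr_gt0.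
have tau2 : tau ^+ 2 = w2 by rewrite sqr_sqrtr// ltW.
pose s0 := D / tau; pose ga := l / tau.
pose a2 := q00 - s0 ^+ 2; pose b := L0 - s0 * ga.
(* Cauchy-Schwarz for the component of v0 orthogonal to v1 - v0, of squared norm
   [a2], and for the unit vector along v1 - v0 *)
have CS' x' y' z' : (x' * al + y' * b + z' * ga) ^+ 2 <=
    x' ^+ 2 + y' ^+ 2 * a2 + z' ^+ 2.
  pose k := z' / tau - y' * D / tau ^+ 2.
  have := CS x' (y' - k) k.
  have -> : x' * al + (y' - k) * L0 + k * L1 = x' * al + y' * b + z' * ga.
    by rewrite /k /b /ga /s0 /l; field; rewrite gt_eqF.
  suff -> : (y' - k) ^+ 2 * q00 + 2 * ((y' - k) * k) * q01 + k ^+ 2 * q11 =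
     y' ^+ 2 * a2 + z' ^+ 2 by rewrite addrA.
  have -> : q11 = tau ^+ 2 + 2 * D + q00 by rewrite tau2 /w2 /D; ring.
  have -> : q01 = D + q00 by rewrite /D; ring.
  by rewrite /k /a2 /s0; field; rewrite gt_eqF.
have a20 : 0 <= a2.
  by have := CS' 0 1 0; have := sqr_ge0 (0 * al + 1 * b + 0 * ga); lra.
pose a := Num.sqrt a2.
have a0 : 0 <= a by exact: sqrtr_ge0.
have aa : a ^+ 2 = a2 by rewrite sqr_sqrtr.
have [be abe be2] : exists2 be, a * be = b &
    be ^+ 2 = (if a == 0 then 0 else b ^+ 2 / a2).
  have [az|an] := eqVneq a 0.
    exists 0; last by rewrite expr0n.
    rewrite mulr0; apply/esym/eqP; rewrite -sqrf_eq0 eq_le sqr_ge0 andbT.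
    by have := CS' 0 1 0; rewrite -aa az; lra.
  by exists (b / a); [rewrite mulrC divfK|rewrite expr_div_n aa].
have h1 : al ^+ 2 + be ^+ 2 + ga ^+ 2 <= 1.
  set S := _ + _ + _.
  have S2 : S ^+ 2 <= S.
    have [az|an] := eqVneq a 0.
      have := CS' al 0 ga; rewrite /S be2 az eqxx; lra.
    have := CS' al (b / a2) ga; rewrite /S be2 (negbTE an).
    have -> : (b / a2) ^+ 2 * a2 = b ^+ 2 / a2 by field; rewrite -aa expf_neq0.
    have -> : (b / a2) * b = b ^+ 2 / a2 by ring.
    by rewrite -!expr2.
  by clearbody S; nra.
have Qs s : Q s = a ^+ 2 + (s0 + tau * s) ^+ 2.
  by rewrite QE aa /a2 -tau2 /s0; field; rewrite gt_eqF.
have us s : u s = sphere_exp al be ga a (s0 + tau * s).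
  rewrite /sphere_exp -Qs /u; congr (_ + _ * _).
  by rewrite abe /b /ga /l; field; rewrite gt_eqF.
pose inv s := (s - s0) / tau.
have invI s : s0 <= s <= s0 + tau -> 0 <= inv s <= 1 /\ s0 + tau * inv s = s.
  move=> /andP[ss s1]; split; last by rewrite /inv; field; rewrite gt_eqF.
  by rewrite /inv ler_pdivrMr// mul1r divr_ge0 ?subr_ge0 ?(ltW tau0)//=; lra.
have sI s : 0 <= s <= 1 -> s0 <= s0 + tau * s <= s0 + tau.
  move=> /andP[sp s1]; rewrite lerDl lerD2l mulr_ge0 ?(ltW tau0)//=.
  by rewrite ger_pMr.
have key := @sphere_exp_convex al be ga a s0 (s0 + tau) a0 h1 _ _
  (s0 + tau * x) (s0 + tau * y) t (s0 + tau * z) (sI _ xI) (sI _ yI) tI _.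
rewrite !us !Qs.
have {}key := key _ _ _.
suff : (s0 + tau * z) ^+ 2 - acos (sphere_exp al be ga a (s0 + tau * z)) ^+ 2 <=
  (1 - t) * ((s0 + tau * x) ^+ 2 - acos (sphere_exp al be ga a (s0 + tau * x)) ^+ 2) +
  t * ((s0 + tau * y) ^+ 2 - acos (sphere_exp al be ga a (s0 + tau * y)) ^+ 2) by lra.
apply: key.
- by move=> s /invI[iI <-]; rewrite -Qs Qpi.
- by move=> s /invI[iI <-]; rewrite -us u01.
- by rewrite zE; ring.
Qed.

End sphere_convexity.

(** * The inner product of square-integrable functions *)

Section square_integrable.
Context d (X : measurableType d) (R : realType) (la : {measure set X -> \bar R}).
Implicit Types (f g h : X -> R) (a b : R).

Definition square_integrable f :=
  measurable_fun setT f /\ la.-integrable setT (EFin \o (fun x => f x ^+ 2)).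

Definition inner f g : R := \int[la]_x (f x * g x).

Definition lincomb a f b g : X -> R := fun x => a * f x + b * g x.

Lemma square_integrable_mul f g : square_integrable f -> square_integrable g ->
  la.-integrable setT (EFin \o (fun x => f x * g x)).
Proof.
move=> [mf f2] [mg g2].
apply: (le_integrable measurableT _ _ (integrableD measurableT f2 g2)) => //.
  by apply/measurable_EFinP; exact: measurable_funM.
move=> x _ /=; rewrite lee_fin normrM [leRHS]ger0_norm ?addr_ge0 ?sqr_ge0//.
rewrite -(real_normK (num_real (f x))) -(real_normK (num_real (g x))).
have := sqr_ge0 (`|f x| - `|g x|); have := normr_ge0 (f x); have := normr_ge0 (g x).
by nra.
Qed.

Lemma square_integrable_lincomb a f b g :
  square_integrable f -> square_integrable g ->
  square_integrable (lincomb a f b g).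
Proof.
move=> f2 g2; have fg := square_integrable_mul f2 g2.
case: f2 g2 => mf f2 [mg g2]; split.
  by apply: measurable_funD; exact: measurable_funM.
have := integrableD measurableT (integrableD measurableT
  (integrableZl measurableT (a ^+ 2) f2) (integrableZl measurableT (2 * a * b) fg))
  (integrableZl measurableT (b ^+ 2) g2).
apply: eq_integrable => // x _ /=.
by rewrite -!EFinM -!EFinD /lincomb; congr EFin; ring.
Qed.

Lemma innerC f g : inner f g = inner g f.
Proof. by apply: eq_Rintegral => x _; rewrite mulrC. Qed.

Lemma inner_lincombl a f b g h :
  square_integrable f -> square_integrable g -> square_integrable h ->
  inner (lincomb a f b g) h = a * inner f h + b * inner g h.
Proof.
move=> f2 g2 h2.
have fh := square_integrable_mul f2 h2; have gh := square_integrable_mul g2 h2.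
rewrite /inner -RintegralZl// -RintegralZl// -RintegralD//.
- by apply: eq_Rintegral => x _; rewrite /lincomb; ring.
- have := integrableZl measurableT a fh; apply: eq_integrable => // x _ /=.
- have := integrableZl measurableT b gh; apply: eq_integrable => // x _ /=.
Qed.

Lemma inner_lincombr a f b g h :
  square_integrable f -> square_integrable g -> square_integrable h ->
  inner h (lincomb a f b g) = a * inner h f + b * inner h g.
Proof. by move=> f2 g2 h2; rewrite innerC inner_lincombl// !(innerC h). Qed.

Lemma inner_ge0 f g : (forall x, 0 <= f x) -> (forall x, 0 <= g x) ->
  0 <= inner f g.
Proof. by move=> f0 g0; apply: Rintegral_ge0 => x _; rewrite mulr_ge0. Qed.

Lemma inner_self_ge0 f : 0 <= inner f f.
Proof. by apply: Rintegral_ge0 => x _; rewrite -expr2 sqr_ge0. Qed.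

(** Cauchy-Schwarz, from the nonnegative norm of the residual of f along h. *)
Lemma inner_sqr_le f h : square_integrable f -> square_integrable h ->
  inner h h <= 1 -> inner f h ^+ 2 <= inner f f.
Proof.
move=> f2 h2 h1; pose t := inner f h.
have th2 : square_integrable (lincomb 1 f (- t) h).
  exact: square_integrable_lincomb.
have := inner_self_ge0 (lincomb 1 f (- t) h).
rewrite inner_lincombl// !inner_lincombr// (innerC h f) -/t.
have : t ^+ 2 * inner h h <= t ^+ 2 by rewrite ler_piMr// sqr_ge0.
by lra.
Qed.

End square_integrable.

(** * Square roots of densities *)

Section root_density.
Context d (X : measurableType d) (R : realType).

Definition root_density (la : set X -> \bar R) (f : X -> R)
    (mu : set X -> \bar R) :=
  [/\ measurable_fun setT f, forall x, 0 <= f x &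
      forall A, measurable A -> mu A = (\int[la]_(x in A) (f x ^+ 2)%:E)%E].

Lemma root_density_dominates (la : {sigma_finite_measure set X -> \bar R}) f
    (mu : {finite_measure set X -> \bar R}) :
  root_density la f mu -> mu `<< la.
Proof.
move=> [mf f0 muE]; apply/null_content_dominatesP => A mA laA.
rewrite muE//; apply: null_set_integral => //.
by apply/measurable_EFinP; apply: measurable_funX; exact: measurable_funTS.
Qed.

Lemma ae_eq_Radon_Nikodym_root_density
    (la : {sigma_finite_measure set X -> \bar R}) f (mu : {finite_measure set X -> \bar R}) :
  root_density la f mu ->
  ae_eq la setT ('d (charge_of_finite_measure mu) '/d la)
    (EFin \o (fun x => f x ^+ 2)).
Proof.
move=> fmu; have mula := root_density_dominates fmu; case: fmu => mf f0 muE.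
apply: integral_ae_eq => //.
- by apply: Radon_Nikodym_integrable.
- by apply/measurable_EFinP; exact: measurable_funX.
- move=> A _ mA; rewrite -Radon_Nikodym_integral//.
  exact: muE.
Qed.

Lemma root_density_square_integrable (la : {measure set X -> \bar R}) f
    (mu : {finite_measure set X -> \bar R}) :
  root_density la f mu -> square_integrable la f.
Proof.
move=> [mf f0 muE]; split=> //; apply/integrableP; split.
  by apply/measurable_EFinP; exact: measurable_funX.
under eq_integral => x _ do rewrite /= ger0_norm ?sqr_ge0//.
by rewrite -muE// ltey_eq fin_num_measure.
Qed.

Lemma root_density_inner1 (la : {measure set X -> \bar R}) f
    (mu : probability X R) :
  root_density la f mu -> inner la f f = 1.
Proof.
move=> [mf f0 muE]; rewrite /inner /Rintegral.
under eq_integral do rewrite -expr2.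
by rewrite -muE// probability_setT.
Qed.

Lemma hellinger2_root_density (la : {sigma_finite_measure set X -> \bar R}) f g
    (mu nu : {finite_measure set X -> \bar R}) :
  root_density la f mu -> root_density la g nu ->
  hellinger2 mu nu = \int[la]_x (f x - g x) ^+ 2.
Proof.
move=> fmu gnu.
have mula := root_density_dominates fmu.
have nula := root_density_dominates gnu.
have fE := ae_eq_Radon_Nikodym_root_density fmu.
have gE := ae_eq_Radon_Nikodym_root_density gnu.
case: fmu gnu => [mf f0 _] [mg g0 _].
rewrite -(hellinger2_wrtE mula nula) /hellinger2_wrt /Rintegral; congr fine.
have mD (m : {finite_measure set X -> \bar R}) : m `<< la ->
    measurable_fun setT (fun x =>
      Num.sqrt (fine (('d (charge_of_finite_measure m) '/d la) x))).
  move=> mk; apply: measurableT_comp.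
    by apply: continuous_measurable_fun; exact: sqrt_continuous.
  apply: measurableT_comp; first exact: fine_measurable.
  exact: measurable_int
    (Radon_Nikodym_integrable (nu := charge_of_finite_measure m) mk).
apply: ae_eq_integral => //.
- apply/measurable_EFinP; apply: measurable_funX.
  by apply: measurable_funB; exact: mD.
- by apply/measurable_EFinP; apply: measurable_funX; exact: measurable_funB.
- apply: filterS2 fE gE => x /(_ I) -> /(_ I) -> _ /=.
  by rewrite !sqrtr_sqr !ger0_norm.
Qed.

Lemma FR2_root_density (la : {sigma_finite_measure set X -> \bar R}) f g
    (mu nu : probability X R) :
  root_density la f mu -> root_density la g nu ->
  FR2 mu nu = acos (inner la f g) ^+ 2.
Proof.
move=> fmu gnu; rewrite /FR2 /FR (hellinger2_root_density fmu gnu).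
congr (acos _ ^+ 2).
have f2 := root_density_square_integrable fmu.
have g2 := root_density_square_integrable gnu.
have -> : \int[la]_x (f x - g x) ^+ 2 = inner la (lincomb 1 f (-1) g) (lincomb 1 f (-1) g).
  by apply: eq_Rintegral => x _; rewrite /lincomb; ring.
have h2 := square_integrable_lincomb 1 (-1) f2 g2.
rewrite inner_lincombl// !inner_lincombr// (innerC la g f).
by rewrite (root_density_inner1 fmu) (root_density_inner1 gnu); field.
Qed.

Lemma root_density_exists (la : {sigma_finite_measure set X -> \bar R})
    (mu : {finite_measure set X -> \bar R}) :
  mu `<< la -> exists f, root_density la f mu.
Proof.
move=> mula.
exists (fun x => Num.sqrt (fine (Radon_Nikodym_SigmaFinite.f mu la x))); split.
- apply: measurableT_comp.
    by apply: continuous_measurable_fun; exact: sqrt_continuous.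
  apply: measurableT_comp; first exact: fine_measurable.
  exact: measurable_int (Radon_Nikodym_SigmaFinite.f_integrable mula).
- by move=> x; exact: sqrtr_ge0.
- move=> A mA; rewrite (Radon_Nikodym_SigmaFinite.f_integral mula)//.
  apply: eq_integral => x _.
  rewrite sqr_sqrtr ?fine_ge0 ?Radon_Nikodym_SigmaFinite.f_ge0//.
  by rewrite fineK// Radon_Nikodym_SigmaFinite.f_fin_num.
Qed.

Lemma dominates_sum_measurel (mu nu : {finite_measure set X -> \bar R}) :
  mu `<< sum_measure mu nu.
Proof.
apply/null_content_dominatesP => A mA rA0; apply/eqP.
have /esym : sum_measure mu nu A = (mu A + nu A)%E by exact: measure_addE.
rewrite rA0 => /eqP.
by rewrite padde_eq0 ?measure_ge0// => /andP[].
Qed.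

Lemma dominates_sum_measurer (mu nu : {finite_measure set X -> \bar R}) :
  nu `<< sum_measure mu nu.
Proof.
apply/null_content_dominatesP => A mA rA0; apply/eqP.
have /esym : sum_measure mu nu A = (mu A + nu A)%E by exact: measure_addE.
rewrite rA0 => /eqP.
by rewrite padde_eq0 ?measure_ge0// => /andP[].
Qed.

Lemma ge0_integral_root_density (rho : {sigma_finite_measure set X -> \bar R}) w
    (la : {finite_measure set X -> \bar R}) (A : set X) (F : X -> R) :
  root_density rho w la -> measurable A -> measurable_fun setT F ->
  (forall x, 0 <= F x) ->
  (\int[la]_(x in A) (F x)%:E = \int[rho]_(x in A) (F x * w x ^+ 2)%:E)%E.
Proof.
move=> wla mA mF F0; have larho := root_density_dominates wla.
have [mw w0 _] := wla.
rewrite -(Radon_Nikodym_SigmaFinite.change_of_variables larho)//; last first.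
  by apply/measurable_EFinP; exact: measurable_funTS.
apply: ae_eq_integral => //.
- apply: emeasurable_funM; first by apply/measurable_EFinP; exact: measurable_funTS.
  apply: measurable_funTS.
  exact: measurable_int (Radon_Nikodym_SigmaFinite.f_integrable larho).
- apply/measurable_EFinP; apply: measurable_funTS; apply: measurable_funM => //.
  exact: measurable_funX.
- apply: filterS2 (ae_eq_Radon_Nikodym_root_density wla)
    (ae_eq_Radon_Nikodym_SigmaFinite larho measurableT) => x.
  by move=> /(_ I) E /(_ I) -> _; rewrite E /= EFinM.
Qed.

(** Let w^2 and k^2 be the densities of la and nu with respect to la + nu. A
    measure with density f^2 with respect to la has density (f w)^2 with respect
    to the sum, and the integral of (f w) k against the sum is the integral of
    f (k / w) against la. So h = k / w, which is 0 where w = 0: the part of nu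
    singular to la is lost, and the norm of h can be less than 1. *)
Lemma FR2_inner_root_density (la : {finite_measure set X -> \bar R})
    (nu : probability X R) :
  exists h, [/\ square_integrable la h, forall x, 0 <= h x, inner la h h <= 1 &
    forall f (mu : probability X R), root_density la f mu ->
      FR2 mu nu = acos (inner la f h) ^+ 2].
Proof.
pose rho : {finite_measure set X -> \bar R} := sum_measure la nu.
have [w wE] := root_density_exists (@dominates_sum_measurel la nu).
have [k krho] := root_density_exists (@dominates_sum_measurer la nu).
have [mk k0 kE] := krho; have [mw w0 _] := wE.
have cov A F := @ge0_integral_root_density rho w la A F wE.
pose h x := k x / w x.
have mh : measurable_fun setT h.
  apply: measurable_funM => //.
  (* real powers are measurable, and give 0 at 0, as inversion does *)
  have -> : (fun x => (w x)^-1) = (fun x => w x `^ (-1)).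
    by apply/funext => x; rewrite powR_inv1.
  exact: (measurableT_comp (measurable_powR (-1))).
have h0 x : 0 <= h x by rewrite divr_ge0.
have hh : (\int[la]_x (h x ^+ 2)%:E <= 1)%E.
  rewrite cov//; last 2 first.
    exact: measurable_funX.
    by move=> x; rewrite sqr_ge0.
  apply: (@le_trans _ _ (nu setT)); last by rewrite probability_setT.
  rewrite kE//.
  apply: ge0_le_integral => //.
  - by move=> x _; rewrite lee_fin mulr_ge0 ?sqr_ge0.
  - by apply/measurable_EFinP; apply: measurable_funM; exact: measurable_funX.
  - by apply/measurable_EFinP; exact: measurable_funX.
  - move=> x _; rewrite lee_fin -exprMn /h.
    have [->|wx] := eqVneq (w x) 0; first by rewrite mulr0 expr0n sqr_ge0.
    by rewrite divfK.
have h2 : square_integrable la h.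
  split => //; apply/integrableP; split.
    by apply/measurable_EFinP; exact: measurable_funX.
  under eq_integral => x _ do rewrite /= ger0_norm ?sqr_ge0//.
  by rewrite (le_lt_trans hh)// ltry.
exists h; split=> //.
  rewrite /inner /Rintegral -[leRHS]/(fine 1%:E) fine_le//.
  exact: integrable_fin_num (square_integrable_mul h2 h2).
move=> f mu [mf f0 fE].
have fw : root_density rho (fun x => f x * w x) mu.
  split.
  - exact: measurable_funM.
  - by move=> x; rewrite mulr_ge0.
  - move=> A mA; rewrite fE// cov//.
    + by apply: eq_integral => x _; rewrite exprMn.
    + exact: measurable_funX.
    + by move=> x; rewrite sqr_ge0.
rewrite (FR2_root_density fw krho); congr (acos _ ^+ 2).
rewrite /inner /Rintegral cov//.
- congr fine; apply: eq_integral => x _; congr EFin; rewrite /h.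
  have [->|wx] := eqVneq (w x) 0; first by rewrite invr0 !mulr0 !mul0r.
  by field.
- exact: measurable_funM.
- by move=> x; rewrite mulr_ge0.
Qed.

End root_density.

Section root_density_probability.
Context d (X : measurableType d) (R : realType) (la : {measure set X -> \bar R}).
Context (f : X -> R) (f2 : square_integrable la f) (f1 : inner la f f = 1).

Definition root_density_probability (A : set X) : \bar R :=
  (\int[la]_(x in A) (f x ^+ 2)%:E)%E.

Let rdp0 : root_density_probability set0 = 0%E.
Proof. exact: integral_set0. Qed.

Let rdp_ge0 A : (0 <= root_density_probability A)%E.
Proof. by apply: integral_ge0 => x _; rewrite lee_fin sqr_ge0. Qed.

Let rdp_sigma_additive : semi_sigma_additive root_density_probability.
Proof.
apply: semi_sigma_additive_nng_induced => [|x]; last by rewrite lee_fin sqr_ge0.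
by case: f2 => _ /measurable_int.
Qed.

HB.instance Definition _ := isMeasure.Build _ _ _ root_density_probability
  rdp0 rdp_ge0 rdp_sigma_additive.

Let rdp_setT : root_density_probability setT = 1%E.
Proof.
case: f2 => _ /(integrable_fin_num measurableT) /fineK E.
by rewrite /root_density_probability -[LHS]E; congr EFin; exact: f1.
Qed.

HB.instance Definition _ :=
  Measure_isProbability.Build _ _ _ root_density_probability rdp_setT.

Lemma root_density_probability_exists : (forall x, 0 <= f x) ->
  exists mu : probability X R, root_density la f mu.
Proof.
by move=> f0; exists root_density_probability; split => //; case: f2.
Qed.

End root_density_probability.

(** * The c-segment of two nonnegative unit vectors *)

Section csegment.
Context d (X : measurableType d) (R : realType) (la : {measure set X -> \bar R}).
Context (g f0 f1 : X -> R).
Context (g2 : square_integrable la g) (f02 : square_integrable la f0)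
  (f12 : square_integrable la f1).
Context (gp : forall x, 0 <= g x) (f0p : forall x, 0 <= f0 x)
  (f1p : forall x, 0 <= f1 x).
Context (g1 : inner la g g = 1) (f01 : inner la f0 f0 = 1)
  (f11 : inner la f1 f1 = 1).
Implicit Types (f h : X -> R) (s : R).

Definition sphere_angle f : R := acos (inner la f g).

(** The logarithm at g. If f = g then the angle vanishes, and division by zero
    makes the logarithm vanish as it should. It is not written with [lincomb]
    so that the bilinearity lemmas stop at it. *)
Definition sphere_log f : X -> R := fun x =>
  sphere_angle f / sin (sphere_angle f) * f x -
  sphere_angle f * cos (sphere_angle f) / sin (sphere_angle f) * g x.

Lemma sphere_log_lincomb f :
  let th := sphere_angle f in
  sphere_log f = lincomb (th / sin th) f (- (th * cos th / sin th)) g.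
Proof. by apply/funext => x; rewrite /lincomb mulNr. Qed.

Lemma square_integrable_sphere_log f : square_integrable la f ->
  square_integrable la (sphere_log f).
Proof.
by move=> f2; rewrite sphere_log_lincomb; exact: square_integrable_lincomb.
Qed.

Lemma inner_unit_itv f h : square_integrable la f -> square_integrable la h ->
  (forall x, 0 <= f x) -> (forall x, 0 <= h x) ->
  inner la f f = 1 -> inner la h h <= 1 -> 0 <= inner la f h <= 1.
Proof.
move=> f2 h2 fp hp fu hu; have i0 := inner_ge0 la fp hp; rewrite i0/=.
have := inner_sqr_le f2 h2 hu; rewrite fu.
by nra.
Qed.

Section one_point.
Context (f : X -> R) (f2 : square_integrable la f) (fp : forall x, 0 <= f x)
  (fu : inner la f f = 1).

Let c01 : 0 <= inner la f g <= 1.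
Proof. by apply: inner_unit_itv => //; rewrite g1. Qed.

Let cN : -1 <= inner la f g <= 1.
Proof. by case/andP: c01 => c0 ->; rewrite andbT (le_trans _ c0)// lerN10. Qed.

Lemma cos_sphere_angle : cos (sphere_angle f) = inner la f g.
Proof. by rewrite /sphere_angle acosK// in_itv. Qed.

Lemma sphere_angle_itv : 0 <= sphere_angle f <= pi / 2.
Proof. by rewrite /sphere_angle acos_ge0//= acos_le_pihalf. Qed.

Lemma sphere_angle_eq0_or : sphere_angle f = 0 \/ 0 < sin (sphere_angle f).
Proof.
have /andP[] := sphere_angle_itv; rewrite le_eqVlt => /predU1P[<-|t0 tpi].
  by left.
by right; apply: sin_gt0_pihalf_le; rewrite t0.
Qed.

Lemma inner_sphere_logr : inner la g (sphere_log f) = 0.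
Proof.
rewrite sphere_log_lincomb inner_lincombr// g1 (innerC la g) -cos_sphere_angle.
by rewrite mulr1 -mulrA [_^-1 * _]mulrC mulrA subrr.
Qed.

Lemma inner_sphere_log_self :
  inner la (sphere_log f) (sphere_log f) = sphere_angle f ^+ 2.
Proof.
rewrite {1}sphere_log_lincomb inner_lincombl//; last first.
  exact: square_integrable_sphere_log.
rewrite inner_sphere_logr mulr0 addr0 sphere_log_lincomb inner_lincombr// fu.
rewrite -cos_sphere_angle.
have [->|s0] := sphere_angle_eq0_or; first by rewrite !mul0r expr0n.
have -> : 1 = cos (sphere_angle f) ^+ 2 + sin (sphere_angle f) ^+ 2.
  by rewrite cos2Dsin2.
by field; rewrite gt_eqF.
Qed.

Lemma inner_sphere_log_eq0 h : square_integrable la h ->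
  sphere_angle f = 0 -> inner la (sphere_log f) h = 0.
Proof.
move=> h2 t0; rewrite sphere_log_lincomb inner_lincombl// t0.
by rewrite !mul0r oppr0 !mul0r addr0.
Qed.

(** The exponential of the logarithm of f is f, tested against vectors h: if the
    angle is 0, then f and g are only equal almost everywhere. *)
Lemma inner_sphere_exp_log h : square_integrable la h -> inner la h h <= 1 ->
  let th := sphere_angle f in
  cos th * inner la g h + sin th / th * inner la (sphere_log f) h = inner la f h.
Proof.
move=> h2 hu th; have [t0|s0] := sphere_angle_eq0_or.
  have c1 : inner la f g = 1 by rewrite -cos_sphere_angle t0 cos0.
  rewrite /th t0 cos0 sin0 mul0r mul0r mul1r addr0.
  apply/eqP; rewrite eq_sym -subr_eq0 -sqrf_eq0 eq_le sqr_ge0 andbT.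
  have := inner_sqr_le (square_integrable_lincomb 1 (-1) f2 g2) h2 hu.
  rewrite inner_lincombl// inner_lincombl//; last exact: square_integrable_lincomb.
  by rewrite !inner_lincombr// (innerC la g f) c1 fu g1; lra.
have t0 : th != 0 by apply: contraTneq s0 => t0; rewrite -/th t0 sin0 ltxx.
by rewrite sphere_log_lincomb inner_lincombl// -/th; field; rewrite t0 /= gt_eqF.
Qed.

End one_point.

Let v s := lincomb (1 - s) (sphere_log f0) s (sphere_log f1).

Let v2 s : square_integrable la (v s).
Proof. by apply: square_integrable_lincomb; exact: square_integrable_sphere_log. Qed.

Definition csegment_sqr s : R := inner la (v s) (v s).

(** The exponential at g of the point [v s] of the segment of logarithms; if
    [v s] has norm 0, division by zero makes it g. *)
Definition csegment s : X -> R :=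
  let r := Num.sqrt (csegment_sqr s) in lincomb (cos r) g (sin r / r) (v s).

Let q00 := inner la (sphere_log f0) (sphere_log f0).
Let q01 := inner la (sphere_log f0) (sphere_log f1).
Let q11 := inner la (sphere_log f1) (sphere_log f1).
Let l02 : square_integrable la (sphere_log f0).
Proof. exact: square_integrable_sphere_log. Qed.
Let l12 : square_integrable la (sphere_log f1).
Proof. exact: square_integrable_sphere_log. Qed.

Lemma csegment_sqrE s : csegment_sqr s =
  (1 - s) ^+ 2 * q00 + 2 * (s * (1 - s)) * q01 + s ^+ 2 * q11.
Proof.
rewrite /csegment_sqr {1}/v inner_lincombl// !inner_lincombr//.
by rewrite (innerC la (sphere_log f1) (sphere_log f0)) -/q00 -/q01 -/q11; ring.
Qed.

Lemma square_integrable_csegment s : square_integrable la (csegment s).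
Proof. exact: square_integrable_lincomb. Qed.

Lemma inner_csegment s h : square_integrable la h ->
  inner la (csegment s) h =
  inner la g h * cos (Num.sqrt (csegment_sqr s)) +
  sin (Num.sqrt (csegment_sqr s)) / Num.sqrt (csegment_sqr s) *
    ((1 - s) * inner la (sphere_log f0) h + s * inner la (sphere_log f1) h).
Proof. by move=> h2; rewrite !inner_lincombl// mulrC. Qed.

Let inner_gv s : inner la g (v s) = 0.
Proof. by rewrite inner_lincombr// !inner_sphere_logr// !mulr0 addr0. Qed.

Lemma inner_csegment_base s :
  inner la (csegment s) g = cos (Num.sqrt (csegment_sqr s)).
Proof.
by rewrite inner_lincombl// (innerC la (v s)) inner_gv g1 mulr0 mulr1 addr0.
Qed.

Lemma inner_csegment_self s : inner la (csegment s) (csegment s) = 1.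
Proof.
rewrite {2}/csegment inner_lincombr ?inner_csegment_base//; last first.
  exact: square_integrable_csegment.
rewrite inner_lincombl// inner_gv mulr0 add0r -/(csegment_sqr s).
set Q := csegment_sqr s; have Q0 : 0 <= Q by exact: inner_self_ge0.
rewrite -[X in _ / _ * (_ / _ * X)](sqr_sqrtr Q0); set r := Num.sqrt Q.
have [->|r0] := eqVneq r 0; first by rewrite cos0 sin0 !mul0r addr0 mulr1.
by rewrite -[RHS](cos2Dsin2 r); field.
Qed.

(** The triangle inequality for (1 - s) v0 + s v1. *)
Lemma csegment_norm_le s : 0 <= s <= 1 ->
  Num.sqrt (csegment_sqr s) <=
  (1 - s) * sphere_angle f0 + s * sphere_angle f1.
Proof.
move=> /andP[s0 s1].
have /andP[t0 _] := sphere_angle_itv f02 f0p f01.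
have /andP[t1 _] := sphere_angle_itv f12 f1p f11.
have R0 : 0 <= (1 - s) * sphere_angle f0 + s * sphere_angle f1.
  by rewrite addr_ge0// mulr_ge0// subr_ge0.
rewrite -(ler_pXn2r (n := 2))// ?nnegrE ?sqrtr_ge0// sqr_sqrtr ?inner_self_ge0//.
rewrite csegment_sqrE /q00 /q11 !inner_sphere_log_self//.
have q01E : q01 <= sphere_angle f0 * sphere_angle f1.
  rewrite /q01.
  move: t0; rewrite le_eqVlt => /predU1P[t0|t0].
    by rewrite inner_sphere_log_eq0// -t0 mul0r.
  move: t1; rewrite le_eqVlt => /predU1P[t1|t1].
    by rewrite innerC inner_sphere_log_eq0// -t1 mulr0.
  have := inner_self_ge0 la (lincomb (sphere_angle f1) (sphere_log f0)
     (- sphere_angle f0) (sphere_log f1)).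
  rewrite inner_lincombl//; last exact: square_integrable_lincomb.
  rewrite !inner_lincombr// (innerC la (sphere_log f1) (sphere_log f0)).
  rewrite !inner_sphere_log_self// => H.
  rewrite -(ler_pM2l (x := 2 * sphere_angle f0 * sphere_angle f1)).
    by lra.
  by rewrite !mulr_gt0.
have : 0 <= 2 * (s * (1 - s)) * (sphere_angle f0 * sphere_angle f1 - q01).
  by rewrite mulr_ge0 ?subr_ge0// mulr_ge0// mulr_ge0// subr_ge0.
by lra.
Qed.

Lemma csegment_angle_le_pihalf s : 0 <= s <= 1 ->
  Num.sqrt (csegment_sqr s) <= pi / 2.
Proof.
move=> sI; apply: le_trans (csegment_norm_le sI) _.
have /andP[_ t0] := sphere_angle_itv f02 f0p f01.
have /andP[_ t1] := sphere_angle_itv f12 f1p f11.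
have /andP[s0 s1] := sI.
have : 0 <= (1 - s) * (pi / 2 - sphere_angle f0) by rewrite mulr_ge0 ?subr_ge0.
have : 0 <= s * (pi / 2 - sphere_angle f1) by rewrite mulr_ge0 ?subr_ge0.
by lra.
Qed.

(** Up to the factor sin r / r, the coefficient of g is the difference between
    r cot r and the average of the numbers th cot th for the angles th of f0 and
    f1 (0 if the angle is 0). It is nonnegative because [onemcot] is convex and
    nondecreasing and r is at most the average angle. *)
Lemma csegment_ge0 s x : 0 <= s <= 1 -> 0 <= csegment s x.
Proof.
move=> sI; have [s0 s1] := andP sI.
have th0I := sphere_angle_itv f02 f0p f01.
have th1I := sphere_angle_itv f12 f1p f11.
have rpi := csegment_angle_le_pihalf sI.
have rR := csegment_norm_le sI.
rewrite /csegment; set r := Num.sqrt _ in rpi rR *.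
have : 0 <= r by exact: sqrtr_ge0.
rewrite le_eqVlt => /predU1P[<-|r0].
  by rewrite /lincomb cos0 sin0 !mul0r addr0 mul1r.
have rI : 0 < r <= pi / 2 by rewrite r0.
have sr := sin_gt0_pihalf_le rI.
have rho_ge0 f : 0 <= sphere_angle f <= pi / 2 ->
    0 <= sphere_angle f / sin (sphere_angle f).
  move=> /andP[t0 tpi]; have pi0 := @pi_ge0 R.
  by rewrite divr_ge0// sin_ge0_pi// t0/=; lra.
have k0 : 0 <= sin r / r by rewrite divr_ge0// ltW.
have -> : lincomb (cos r) g (sin r / r) (v s) x =
  sin r / r * ((r * cos r / sin r
   - (1 - s) * (sphere_angle f0 * cos (sphere_angle f0) / sin (sphere_angle f0))
   - s * (sphere_angle f1 * cos (sphere_angle f1) / sin (sphere_angle f1))) * g x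
   + (1 - s) * (sphere_angle f0 / sin (sphere_angle f0) * f0 x)
   + s * (sphere_angle f1 / sin (sphere_angle f1) * f1 x)).
  have E : sin r / r * (r * cos r / sin r) = cos r by field; rewrite !gt_eqF.
  rewrite /lincomb /v /lincomb /sphere_log.
  by rewrite -[X in X * g x + _ = _]E; ring.
have H0 := onemcot_tangent rI th0I; have H1 := onemcot_tangent rI th1I.
have d0 : 0 <= onemcot1 r.
  rewrite /onemcot1 divr_ge0 ?sqr_ge0// subr_ge0.
  have := @sin_le_id _ r (ltW r0); have := cos_le1 r; have := ltW sr.
  by nra.
have key : onemcot r <=
    (1 - s) * onemcot (sphere_angle f0) + s * onemcot (sphere_angle f1).
  have : 0 <= (1 - s) * (onemcot (sphere_angle f0) -
      (onemcot r + onemcot1 r * (sphere_angle f0 - r))).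
    by rewrite mulr_ge0 ?subr_ge0.
  have : 0 <= s * (onemcot (sphere_angle f1) -
      (onemcot r + onemcot1 r * (sphere_angle f1 - r))).
    by rewrite mulr_ge0 ?subr_ge0.
  have : 0 <= onemcot1 r * ((1 - s) * sphere_angle f0 + s * sphere_angle f1 - r).
    by rewrite mulr_ge0 ?subr_ge0.
  by lra.
rewrite mulr_ge0// addr_ge0 ?addr_ge0//.
- by rewrite mulr_ge0//; move: key; rewrite /onemcot; lra.
- by rewrite mulr_ge0 ?subr_ge0// mulr_ge0// rho_ge0.
- by rewrite mulr_ge0// mulr_ge0// rho_ge0.
Qed.

Lemma inner_csegment0 h : square_integrable la h -> inner la h h <= 1 ->
  inner la (csegment 0) h = inner la f0 h.
Proof.
move=> h2 hu; rewrite inner_csegment//.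
have -> : csegment_sqr 0 = sphere_angle f0 ^+ 2.
  by rewrite csegment_sqrE /q00 inner_sphere_log_self//; ring.
have /andP[t0 _] := sphere_angle_itv f02 f0p f01.
rewrite sqrtr_sqr ger0_norm// -(inner_sphere_exp_log f02 f0p f01 h2 hu).
by rewrite mul0r addr0 subr0 mul1r [inner la g h * _]mulrC.
Qed.

Lemma inner_csegment1 h : square_integrable la h -> inner la h h <= 1 ->
  inner la (csegment 1) h = inner la f1 h.
Proof.
move=> h2 hu; rewrite inner_csegment//.
have -> : csegment_sqr 1 = sphere_angle f1 ^+ 2.
  by rewrite csegment_sqrE /q11 inner_sphere_log_self//; ring.
have /andP[t0 _] := sphere_angle_itv f12 f1p f11.
rewrite sqrtr_sqr ger0_norm// -(inner_sphere_exp_log f12 f1p f11 h2 hu).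
by rewrite subrr mul0r add0r mul1r [inner la g h * _]mulrC.
Qed.

Lemma acos_inner_csegment_base s : 0 <= s <= 1 ->
  acos (inner la (csegment s) g) ^+ 2 = csegment_sqr s.
Proof.
move=> sI; rewrite inner_csegment_base cosK ?sqr_sqrtr ?inner_self_ge0//.
have := csegment_angle_le_pihalf sI; have pi0 := @pi_ge0 R.
by rewrite in_itv/= sqrtr_ge0/= => ?; lra.
Qed.

Lemma csegment_convex h : square_integrable la h -> (forall x, 0 <= h x) ->
  inner la h h <= 1 ->
  forall x y t z, 0 <= x <= 1 -> 0 <= y <= 1 -> 0 <= t <= 1 ->
  z = (1 - t) * x + t * y ->
  csegment_sqr z - acos (inner la (csegment z) h) ^+ 2 <=
  (1 - t) * (csegment_sqr x - acos (inner la (csegment x) h) ^+ 2) +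
  t * (csegment_sqr y - acos (inner la (csegment y) h) ^+ 2).
Proof.
move=> h2 hp hu x y t z xI yI tI zE.
rewrite !inner_csegment// !csegment_sqrE.
apply: (@gram_line_convex R (inner la g h) (inner la (sphere_log f0) h)
  (inner la (sphere_log f1) h) q00 q01 q11) => //.
- move=> a b c.
  have lc2 : square_integrable la (lincomb b (sphere_log f0) c (sphere_log f1)).
    exact: square_integrable_lincomb.
  have glc2 := square_integrable_lincomb a 1 g2 lc2.
  have := inner_sqr_le glc2 h2 hu; rewrite !inner_lincombl// ?inner_lincombr//.
  rewrite !(innerC la (sphere_log _) g) !inner_sphere_logr// g1.
  rewrite (innerC la (sphere_log f1) (sphere_log f0)) -/q00 -/q01 -/q11.
  by lra.
- by move=> s sI; rewrite -csegment_sqrE csegment_angle_le_pihalf.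
- move=> s sI; rewrite -csegment_sqrE -inner_csegment//.
  apply: inner_unit_itv => //; first exact: square_integrable_csegment.
    by move=> w; exact: csegment_ge0.
  exact: inner_csegment_self.
Qed.

End csegment.

(** * Nonnegative cross-curvature of the squared Fisher-Rao distance *)

Lemma convex_function01P (R : realType) (f : R -> R) :
  convex_function (`[0, 1]%classic : set R^o) f <->
  forall x y t, 0 <= x <= 1 -> 0 <= y <= 1 -> 0 <= t <= 1 ->
    f ((1 - t) * x + t * y) <= (1 - t) * f x + t * f y.
Proof.
split=> [cf x y t xI yI /andP[t0 t1]|cf t x y].
  have u0 : 0 <= 1 - t by lra.
  have u1 : 1 - t <= 1 by lra.
  have xI' : (x : R^o) \in (`[0, 1]%classic : set R^o) by rewrite inE/= in_itv.
  have yI' : (y : R^o) \in (`[0, 1]%classic : set R^o) by rewrite inE/= in_itv.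
  have H : f ((1 - t) * x + (1 - (1 - t)) * y) <=
    (1 - t) * f x + (1 - (1 - t)) * f y := cf (Itv01 u0 u1) x y xI' yI'.
  by rewrite subKr in H.
rewrite !inE/= !in_itv/= => xI yI.
suff : f (t%:num * x + (1 - t%:num) * y) <= t%:num * f x + (1 - t%:num) * f y by [].
have := cf x y (1 - t%:num) xI yI; rewrite subKr; apply.
have t0 : 0 <= t%:num by [].
have t1 : t%:num <= 1 by [].
by apply/andP; split; lra.
Qed.

Lemma NNCC_conv_space (R : realType) (A B : Type) (c : A -> B -> R) :
  NNCC_conv c -> NNCC_space c.
Proof.
move=> cc x0 x1 ybar; have [x [xE0 xE1 conv]] := cc x0 x1 ybar.
exists x; split=> // s y /andP[s0 s1].
have := (convex_function01P _).1 (conv y) 0 1 s.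
rewrite mulr0 add0r mulr1 xE0 xE1 !lexx ler01; apply=> //.
by rewrite !ltW.
Qed.

Theorem proposition4p6 (R : realType) (d : measure_display)
    (X : measurableType d) :
  NNCC_conv (@FR2 d X R) /\ NNCC_space (@FR2 d X R).
Proof.
suff conv : NNCC_conv (@FR2 d X R) by split=> //; exact: NNCC_conv_space.
move=> x0 x1 ybar.
pose la0 : {finite_measure set X -> \bar R} := sum_measure x0 x1.
pose la : {finite_measure set X -> \bar R} := sum_measure la0 ybar.
have la0la : la0 `<< la := @dominates_sum_measurel _ _ _ la0 ybar.
have [f0 f0E] := root_density_exists
  (null_dominates_trans (@dominates_sum_measurel _ _ _ x0 x1) la0la).
have [f1 f1E] := root_density_exists
  (null_dominates_trans (@dominates_sum_measurer _ _ _ x0 x1) la0la).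
have [g gE] := root_density_exists (@dominates_sum_measurer _ _ _ la0 ybar).
have f02 := root_density_square_integrable f0E.
have f12 := root_density_square_integrable f1E.
have g2 := root_density_square_integrable gE.
have f01 := root_density_inner1 f0E.
have f11 := root_density_inner1 f1E.
have g1 := root_density_inner1 gE.
have [_ f0p _] := f0E; have [_ f1p _] := f1E; have [_ gp _] := gE.
pose F := csegment la g f0 f1.
(* The endpoints are the given measures themselves; outside [0, 1] the path is
   arbitrary. *)
have ex s : exists mu : probability X R, [/\ s = 0 -> mu = x0, s = 1 -> mu = x1 &
    0 < s < 1 -> root_density la (F s) mu].
  have [->|s0] := eqVneq s 0.
    by exists x0; split => // [/eqP|]; rewrite ?ltxx// eq_sym oner_eq0.
  have [->|s1] := eqVneq s 1.
    by exists x1; split => // [/eqP|]; rewrite ?ltxx ?andbF// oner_eq0.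
  have [sI|sNI] := boolP (0 < s < 1); last first.
    by exists x0; split => [//|sE|//]; rewrite sE eqxx in s1.
  have [mu muE] := root_density_probability_exists
    (square_integrable_csegment g2 f02 f12 s)
    (inner_csegment_self g2 f02 f12 gp f0p f1p g1 f01 f11 s)
    (fun w => csegment_ge0 g2 f02 f12 gp f0p f1p g1 f01 f11 w
      (let: conj a b := andP sI in introT andP (conj (ltW a) (ltW b)))).
  by exists mu; split => [/eqP|/eqP|//]; [rewrite (negbTE s0)|rewrite (negbTE s1)].
have [x xP] := choice ex.
have x0E : x 0 = x0 by have [H _ _] := xP 0; exact: H.
have x1E : x 1 = x1 by have [_ H _] := xP 1; exact: H.
have cost (nu : probability X R) h : square_integrable la h -> inner la h h <= 1 ->
    (forall f (mu : probability X R), root_density la f mu ->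
      FR2 mu nu = acos (inner la f h) ^+ 2) ->
    forall s, 0 <= s <= 1 -> FR2 (x s) nu = acos (inner la (F s) h) ^+ 2.
  move=> h2 hu hE s /andP[]; rewrite le_eqVlt => /predU1P[<- _|s0].
    by rewrite x0E (hE _ _ f0E) inner_csegment0.
  rewrite le_eqVlt => /predU1P[->|s1].
    by rewrite x1E (hE _ _ f1E) inner_csegment1.
  by have [_ _ H] := xP s; rewrite (hE _ _ (H _))// s0.
have costbar s : 0 <= s <= 1 -> FR2 (x s) ybar = csegment_sqr la g f0 f1 s.
  move=> sI; rewrite (cost ybar g)//.
  - by rewrite acos_inner_csegment_base.
  - by rewrite g1.
  - by move=> f mu fmu; exact: FR2_root_density.
exists x; split=> // y; apply/convex_function01P => a b t aI bI tI.
have [h [h2 hp hu hE]] := FR2_inner_root_density la y.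
have cI := conv_itv aI bI tI.
rewrite !costbar// !(cost y h)//.
exact: csegment_convex.
Qed.
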